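(* Let $f$ be a continuously differentiable function with $f(u)>0$ for all $u>0$. Suppose that there is $x_1$ such that $f'(u)>0$ for all $u>x_1$, that $f'(u)\to0$ as $u\to\infty$, and that $f'$ is regularly varying at infinity with index $0$ (i.e. $f'\in\mathrm{RV}_\infty(0)$). Suppose also that the limit $$\lambda:=\lim_{u\to\infty}\frac{f(u)}{u/\log(u)}\in[0,\infty]$$ exists. Let $\tau>0$, let $\mu$ be a positive finite Borel measure on $[-\tau,0]$ with $M:=\int_{[-\tau,0]}\mu(ds)\in(0,\infty)$, let $C:=\int_{[-\tau,0]}|s|\,\mu(ds)$, and let $\psi\in C([-\tau,0];(0,\infty))$. Then the unique continuous solution $x$ of $$x'(t)=\int_{[-\tau,0]}\mu(ds)\,f(x(t+s)),\quad t>0;\qquad x(t)=\psi(t),\quad t\in[-\tau,0],$$ obeys $$\lim_{t\to\infty}\frac{x(t)}{F^{-1}(Mt)}=e^{-\lambda C},$$ where $$F(v)=\int_1^v\frac{1}{f(u)}\,du,\quad v>0,$$ and $F^{-1}$ is the inverse function of $F$.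
   Context: A measurable function $g$, positive for all sufficiently large arguments, is called regularly varying at infinity with index $\beta\in\mathbb{R}$, written $g\in\mathrm{RV}_\infty(\beta)$, if $g(ct)/g(t)\to c^\beta$ as $t\to\infty$ for every $c>0$. The notation $\int_{[-\tau,0]}\mu(ds)\,h(s)$ means the integral of $h$ over $[-\tau,0]$ with respect to $\mu$. $C([-\tau,0];(0,\infty))$ is the set of continuous functions from $[-\tau,0]$ to $(0,\infty)$. The symbol $e^{-\infty}$ is read as $0$. *)

(* Defs.v *)
From HB Require Import structures.
From mathcomp Require Import all_boot all_order all_algebra.
From mathcomp Require Import all_classical all_reals all_analysis.

Set Implicit Arguments.
Unset Strict Implicit.
Unset Printing Implicit Defensive.

Import Order.TTheory GRing.Theory Num.Theory.
Import numFieldNormedType.Exports.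

Local Open Scope ring_scope.
Local Open Scope classical_set_scope.

(* Only the values of g on (0, +oo) matter: measurability is required there. *)
Definition regularly_varying (R : realType) (g : R -> R) (beta : R) : Prop :=
  [/\ measurable_fun (`]0, +oo[ : set R) g,
      \forall t \near +oo, 0 < g t
    & forall c : R, 0 < c -> g (c * t) / g t @[t --> +oo] --> c `^ beta].

(* \int[mu]_(x in D) is not oriented, while F v is also needed for v < 1. *)
Definition F (R : realType) (f : R -> R) (v : R) : R :=
  if 1 <= v then \int[lebesgue_measure]_(u in `[1, v]) (1 / f u)
  else - \int[lebesgue_measure]_(u in `[v, 1]) (1 / f u).

(* If f > 0 on (0, +oo), F f is strictly increasing there, and for y in its range
   Finv f y is the unique v > 0 such that F f v = y. *)
Definition Finv (R : realType) (f : R -> R) : R -> R :=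
  'pinv_(fun=> 0) `]0, +oo[ (F f).

(* A finite Borel measure on [-tau, 0] is represented by a finite Borel measure
   mu on the line, of which only the restriction to [-tau, 0] is used. *)
Definition is_solution (R : realType) (tau : R)
    (mu : {finite_measure set (measurableTypeR R) -> \bar R})
    (f psi x : R -> R) : Prop :=
  [/\ {within `[- tau, +oo[, continuous x},
      forall t : R, 0 < t ->
        is_derive t (1 : R) x (\int[mu]_(s in `[- tau, 0]) f (x (t + s)))
    & forall t : R, - tau <= t <= 0 -> x t = psi t].

(* Main.v *)
Require Import Defs.
From HB Require Import structures.
From mathcomp Require Import all_boot all_order all_algebra.
From mathcomp Require Import all_classical all_reals all_analysis.
From mathcomp Require Import lra ring.

Import Order.TTheory GRing.Theory Num.Theory.
Import numFieldNormedType.Exports.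

Local Open Scope ring_scope.
Local Open Scope classical_set_scope.

(** Let [G' = 1 / f], so that [(G o x)' = M] would hold without delay, and let
    [phi = ln (f o x)].

    Time scale.  As [f'] tends to 0, so does [phi' <= M f'(x)]: over a window of
    length [tau] the increments of [phi] are uniformly small.  Hence
    [f(x(t+s)) / f(x(t)) = expR (- (phi t - phi (t+s)))] equals
    [1 - (phi t - phi (t+s))] up to a small relative error in the increment, and
    integrating against [mu] gives [(G o x)' = M - (1 + o(1)) q] with
    [q t = \int mu(ds) (phi t - phi (t+s))].  The key is that [q] is an exact
    derivative: with [Phi' = phi], it is the derivative of
    [Q t = \int mu(ds) (Phi t - Phi (t+s))], and [Q] differs from [C phi] by a
    bounded amount since [phi] hardly moves within a window.  So
    [M t - G (x t) = (1 + o(1)) C ln (f (x t)) + O(1)]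
    ([delay_cost_asymptotics]).

    Logarithmic scale.  Let [w t = Finv f (M t)].  The previous estimate bounds
    [G (w t) - G (x t)], and by the mean value theorem in the variable [ln u]
    this difference is [(c / f c) (ln (w t) - ln (x t))] for some [c] in between
    ([log_mean_value]).  If [f u] is close to [l u / ln u], then [c / f c] is
    close to [ln c / l], while [ln (f (x t))] is close to [ln (x t)]; dividing
    by [ln (x t)] gives [ln (w t) - ln (x t)] close to [l C].  The one-sided
    versions [log_gap_lt] and [log_gap_gt] of this comparison, used with [l]
    slightly above or below [lambda], also cover infinite [lambda].  The bounds
    left when [lambda] or [C] vanishes come from a bounded difference of [G],
    which is absorbed because [c / f c] tends to infinity ([log_gap_gt_neg],
    [log_gap_lt_pos]).

    Existence and uniqueness.  A solution cannot go below the minimum [m] of its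
    initial history, and [f] is Lipschitz on [[m, +oo[] because [f'] is
    continuous there and tends to 0.  So [f] may be replaced by a Lipschitz
    function on the whole line, for which Picard iteration halves distances
    weighted by [expR (- K t)]. *)

(** * Increments, primitives and continuity on the line *)

Section Calculus.
Set Implicit Arguments.
Unset Strict Implicit.
Context {R : realType}.
Implicit Types (u v g : R -> R) (a b c t : R).

Lemma is_derive_continuous u t du :
  is_derive t (1 : R) u du -> {for t, continuous u}.
Proof.
move=> [du1 _]; apply: differentiable_continuous.
exact/derivable1_diffP.
Qed.

Lemma within_segment u a b :
  (forall t, a <= t <= b -> {for t, continuous u}) ->
  {within `[a, b], continuous u}.
Proof.
move=> cu; apply: continuous_in_subspaceT => t.
by rewrite inE/= in_itv/= => /cu.
Qed.

Lemma mean_value u du a b : a < b ->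
  (forall t, a <= t <= b -> {for t, continuous u}) ->
  (forall t, a < t < b -> is_derive t 1 u (du t)) ->
  exists2 c, a < c < b & u b - u a = du c * (b - a).
Proof.
move=> ab cu Du.
have Du' t : t \in `]a, b[%R -> is_derive t 1 u (du t).
  by rewrite in_itv/=; exact: Du.
have [c + E] := MVT ab Du' (within_segment cu).
by rewrite in_itv/=; exists c.
Qed.

(** Comparing derivatives replaces integrating rates over time: the estimates
    on solutions all have this form. *)
Lemma le_increment u v du dv a b : a <= b ->
  (forall t, a <= t <= b -> {for t, continuous u}) ->
  (forall t, a <= t <= b -> {for t, continuous v}) ->
  (forall t, a < t < b -> is_derive t 1 u (du t)) ->
  (forall t, a < t < b -> is_derive t 1 v (dv t)) ->
  (forall t, a < t < b -> du t <= dv t) ->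
  u b - u a <= v b - v a.
Proof.
rewrite le_eqVlt => /predU1P[-> *|ab cu cv Du Dv uv]; first by rewrite !subrr.
have [|t tab|c cab /= E] :=
  @mean_value (v \- u) (fun t => dv t - du t) a b ab.
- by move=> t tab; apply: continuousB; [exact: cv|exact: cu].
- by apply: is_deriveB; [exact: Dv|exact: Du].
have : 0 <= (dv c - du c) * (b - a).
  by rewrite mulr_ge0 ?subr_ge0 ?uv ?(ltW ab).
by rewrite -E; lra.
Qed.

Lemma nondecreasing_increment u du a b : a <= b ->
  (forall t, a <= t <= b -> {for t, continuous u}) ->
  (forall t, a < t < b -> is_derive t 1 u (du t)) ->
  (forall t, a < t < b -> 0 <= du t) -> u a <= u b.
Proof.
move=> ab cu Du u0; rewrite -subr_ge0.
have := @le_increment (fun=> 0) u (fun=> 0) du a b ab.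
rewrite subrr; apply => // t _; exact: cst_continuous.
Qed.

Lemma bounded_on_segment u a b :
  {within `[a, b], continuous u} ->
  exists2 B : R, 0 <= B & forall t, a <= t <= b -> `|u t| <= B.
Proof.
have [ab cu|ba _] := leP a b; last first.
  by exists 0 => // t /andP[ /le_trans/[apply]]; rewrite leNgt ba.
have [c1 _ M1] := EVT_max ab cu; have [c2 _ M2] := EVT_min ab cu.
exists (`|u c1| + `|u c2|); first by rewrite addr_ge0.
move=> t tab; have tab' : t \in `[a, b]%R by rewrite in_itv.
have := M1 _ tab'; have := M2 _ tab'.
have := ler_norm (u c1); have := ler_norm (- u c2).
rewrite normrN => *; rewrite ler_norml.
have := normr_ge0 (u c1); have := normr_ge0 (u c2).
by move=> *; apply/andP; split; lra.
Qed.

Lemma continuous_maxr (c : R) : continuous (fun t : R => Num.max t c).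
Proof.
move=> t; apply: (@continuous_max _ _ (fun t : R => t) (fun=> c)) => //.
exact: cst_continuous.
Qed.

Lemma continuous_minr (c : R) : continuous (fun t : R => Num.min t c).
Proof.
move=> t; apply: (@continuous_min _ _ (fun t : R => t) (fun=> c)) => //.
exact: cst_continuous.
Qed.

Lemma within_comp_continuous (A : set R) (u c : R -> R) :
  {within A, continuous u} -> continuous c -> (forall t, A (c t)) ->
  continuous (u \o c).
Proof.
move=> /subspace_continuousP cu cc Ac t.
apply: (@cvg_comp _ _ _ c u (nbhs t) (within A (nbhs (c t)))); last exact: cu.
move=> P AP; have h : \forall s \near t, A (c s) -> P (c s) := cc t _ AP.
change (\forall s \near t, P (c s)).
by apply: filterS h => s; apply; exact: Ac.
Qed.

Lemma ray_extension_continuous a (y : R -> R) :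
  {within `[a, +oo[, continuous y} -> continuous (fun t => y (Num.max t a)).
Proof.
move=> cy; apply: (within_comp_continuous cy (@continuous_maxr a)) => t.
by rewrite /= in_itv/= andbT le_max lexx orbT.
Qed.

Lemma continuous_scaled c g : continuous g -> continuous (fun t => c * g t).
Proof.
move=> cg t; apply: (@continuousM _ _ (fun=> c) g) => //; last exact: cg.
exact: cst_continuous.
Qed.

Lemma continuous_diff u v :
  continuous u -> continuous v -> continuous (fun t => u t - v t).
Proof.
by move=> cu cv t; apply: (@continuousB _ _ _ u v); [exact: cu|exact: cv].
Qed.

(** The one-sided [G t = \int_(a-1)^t g] is frozen to the left of [a], which
    makes it continuous on the whole line; averages over the past of the
    primitive then make sense at every time. *)
Lemma primitive g a : continuous g ->
  exists2 G : R -> R, continuous G & forall t, a < t -> is_derive t 1 G (g t).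
Proof.
move=> cg.
pose G t := \int[lebesgue_measure]_(s in `[a - 1, t]) g s.
have DG t : a - 1 < t -> is_derive t 1 G (g t).
  move=> at_; have t1 : t < t + 1 by rewrite ltrDl.
  have ig : lebesgue_measure.-integrable `[a - 1, t + 1] (EFin \o g).
    apply: continuous_compact_integrable; first exact: segment_compact.
    exact: continuous_subspaceT.
  have [dG GE] := continuous_FTC1_closed t1 ig at_ (cg t).
  by rewrite -GE derive1E; exact/derivableP.
have a1 : a - 1 < a by rewrite ltrBlDr ltrDl.
exists (fun t => G (Num.max t a)).
  move=> t; apply: (@continuous_comp _ _ _ (fun t => Num.max t a)).
    exact: continuous_maxr.
  by apply: is_derive_continuous (DG _ _); rewrite lt_max a1 orbT.
move=> t at_; apply: near_eq_is_derive (DG _ (lt_trans a1 at_)); near=> z.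
rewrite (max_idPl _)//; apply: ltW; near: z; exact: lt_nbhsr.
Unshelve. all: by end_near. Qed.

Lemma is_derive_scale c t : is_derive t (1 : R) (fun t => c * t) c.
Proof.
by have := is_deriveZ c (is_derive_id t (1 : R)); rewrite [c *: _]mulr1.
Qed.

Lemma is_derive_comb (a b : R) u v t (du dv : R) :
  is_derive t (1 : R) u du -> is_derive t (1 : R) v dv ->
  is_derive t 1 (fun t => a * u t - b * v t) (a * du - b * dv).
Proof. by move=> Du Dv; apply: is_deriveB; exact: is_deriveZ. Qed.

Lemma near_gt (A : R) : \forall t \near +oo, A < t.
Proof. exact: (nbhs_pinfty_gt (num_real A)). Qed.

Lemma near_ge (A : R) : \forall t \near +oo, A <= t.
Proof. exact: (nbhs_pinfty_ge (num_real A)). Qed.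

End Calculus.

(** * Integrals of a function over its past *)

Section DelayIntegral.
Set Implicit Arguments.
Unset Strict Implicit.
Context {R : realType} (tau : R)
  (mu : {finite_measure set (measurableTypeR R) -> \bar R}).
Implicit Types (g h Phi phi : R -> R) (a b c t : R).

Definition delay_integral h := \int[mu]_(s in `[- tau, 0]) h s.

Definition delay_mass := fine (mu `[- tau, 0]).

Lemma delay_integrable h : continuous h ->
  mu.-integrable `[- tau, 0] (EFin \o h).
Proof.
move=> ch; apply: measurable_bounded_integrable => //=.
- by rewrite -ge0_fin_numE ?fin_num_measure.
- apply: measurable_funTS; exact: measurable_realfun.continuous_measurable_fun.
- have [B _ hB] := bounded_on_segment (@continuous_subspaceT _ _ `[- tau, 0] _ ch).
  exists B; split; first exact: num_real.
  move=> y By s /=; rewrite in_itv/= => /hB /le_trans; apply; exact: ltW.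
Qed.

Lemma le_delay_integral g h : continuous g -> continuous h ->
  (forall s, - tau <= s <= 0 -> g s <= h s) ->
  delay_integral g <= delay_integral h.
Proof.
by move=> cg ch gh; apply: le_Rintegral => //; exact: delay_integrable.
Qed.

Lemma delay_integralB g h : continuous g -> continuous h ->
  delay_integral (fun s => g s - h s) = delay_integral g - delay_integral h.
Proof.
by move=> cg ch; rewrite /delay_integral RintegralB//; exact: delay_integrable.
Qed.

Lemma delay_integralZ c g : continuous g ->
  delay_integral (fun s => c * g s) = c * delay_integral g.
Proof.
by move=> cg; rewrite /delay_integral RintegralZl//; exact: delay_integrable.
Qed.

Lemma delay_integral_cst c : delay_integral (fun=> c) = c * delay_mass.
Proof. exact: Rintegral_cst. Qed.

Lemma eq_delay_integral g h :
  (forall s, - tau <= s <= 0 -> g s = h s) ->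
  delay_integral g = delay_integral h.
Proof.
by move=> gh; apply: eq_Rintegral => s; rewrite inE/= in_itv/=; exact: gh.
Qed.

Lemma norm_delay_integralB g h B : continuous g -> continuous h ->
  (forall s, - tau <= s <= 0 -> `|g s - h s| <= B) ->
  `|delay_integral g - delay_integral h| <= B * delay_mass.
Proof.
move=> cg ch gh; rewrite -delay_integralB// ler_norml -mulNr.
have cgh : continuous (fun s => g s - h s).
  by move=> s; apply: continuousB; [exact: cg|exact: ch].
rewrite -!delay_integral_cst; apply/andP; split; apply: le_delay_integral => //.
all: try exact: cst_continuous.
all: by move=> s /gh; rewrite ler_norml => /andP[].
Qed.

Lemma continuous_translate g t : continuous g -> continuous (fun s => g (t + s)).
Proof.
move=> cg s; apply: (@continuous_comp _ _ _ (fun s => t + s)) => //.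
  by apply: continuousD => //; exact: cst_continuous.
exact: cg.
Qed.

(** The right-hand side of the equation is [delayed (f \o x)]. *)
Definition delayed g t := delay_integral (fun s => g (t + s)).

Let in_window t s z : `]t - 1, t + 1[%classic z -> - tau <= s <= 0 ->
  t - 1 - tau <= z + s <= t + 1.
Proof. by rewrite /= in_itv/= => /andP[? ?] /andP[? ?]; apply/andP; lra. Qed.

Lemma delayed_continuous g : continuous g -> continuous (delayed g).
Proof.
move=> cg t; have [B B0 gB] := bounded_on_segment
  (@continuous_subspaceT _ _ `[t - 1 - tau, t + 1] _ cg).
apply: (@continuity_under_integral _ _ _ mu (fun z s => g (z + s)) `[- tau, 0] _
  (t - 1) (t + 1) _ _ (fun=> B)) => //.
- by move=> z _; exact/delay_integrable/continuous_translate.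
- apply: aeW => s _ z _; under eq_fun do rewrite addrC.
  exact: continuous_translate.
- exact/delay_integrable/cst_continuous.
- move=> z zt; apply: aeW => s /=; rewrite in_itv/= => st.
  exact/gB/in_window.
- by rewrite inE/= in_itv/=; apply/andP; lra.
Qed.

(** Differentiation under the integral sign, dominated by a bound of [phi] on
    the compact set of all times seen from the unit neighbourhood of [t]. *)
Lemma delayed_derive Phi phi t : continuous Phi -> continuous phi ->
  (forall z, t - 1 - tau <= z -> is_derive z 1 Phi (phi z)) ->
  is_derive t 1 (delayed Phi) (delayed phi t).
Proof.
move=> cPhi cphi DPhi; have [B B0 phiB] := bounded_on_segment
  (@continuous_subspaceT _ _ `[t - 1 - tau, t + 1] _ cphi).
have D z s : `]t - 1, t + 1[%classic z -> - tau <= s <= 0 ->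
    is_derive z 1 (fun z => Phi (z + s)) (phi (z + s)).
  move=> zt st; have /andP[zs _] := in_window zt st.
  have := @is_derive1_comp _ Phi (shift s) z _ _ (DPhi _ zs) (is_derive_shift z 1 s).
  by rewrite mulr1.
have tt : `]t - 1, t + 1[%classic t by rewrite /= in_itv/=; apply/andP; lra.
have D1 z s : `]t - 1, t + 1[%classic z -> `[- tau, 0]%classic s ->
    (fun z => Phi (z + s))^`() z = phi (z + s).
  move=> zt; rewrite /= in_itv/= => st.
  by rewrite derive1E; have [_] := D z s zt st.
have H : h^-1 *: (delayed Phi (h + t) - delayed Phi t) @[h --> 0^'] -->
    delayed phi t.
  have -> : delayed phi t = \int[mu]_(s in `[- tau, 0])
      partial1of2 (fun z s => Phi (z + s)) t s.
    by apply: eq_Rintegral => s; rewrite inE => st; rewrite /partial1of2 D1.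
  apply: (@cvg_differentiation_under_integral _ _ _ mu
    (fun z s => Phi (z + s)) `[- tau, 0] _ t (t - 1) (t + 1) tt _ _ (fun=> B)).
  - by [].
  - by move=> z _; exact/delay_integrable/continuous_translate.
  - by move=> z s zt; rewrite /= in_itv/= => st; have [] := D z s zt st.
  - by [].
  - exact/delay_integrable/cst_continuous.
  - move=> z s zt st; rewrite /partial1of2 D1//; apply: phiB.
    by apply: in_window => //; rewrite /= in_itv in st.
have E : (fun h : R =>
      h^-1 *: ((delayed Phi \o shift t) (h *: (1 : R)) - delayed Phi t)) =
    (fun h : R => h^-1 *: (delayed Phi (h + t) - delayed Phi t)).
  by apply/funext => h /=; rewrite [h *: 1]mulr1.
apply: DeriveDef; first by rewrite /derivable E; apply/cvg_ex; eexists; exact: H.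
by rewrite /derive E; exact: cvg_lim H.
Qed.

End DelayIntegral.

(** * The delay equation with a Lipschitz right-hand side *)

Section Halving.
Set Implicit Arguments.
Unset Strict Implicit.
Context {R : realType}.
Implicit Types (n m : nat).

(** Stands for letting [n] tend to infinity in an inequality. *)
Lemma le_of_halving (a b c : R) : (forall n, a <= b + c / 2 ^+ n) -> a <= b.
Proof.
move=> h; rewrite leNgt; apply/negP => ba.
have [c0|c0] := leP c 0.
  have := h 0; rewrite expr0 divr1; lra.
have ab : 0 < a - b by rewrite subr_gt0.
have [n cn] : exists n, c / (a - b) < n%:R.
  exists (Num.bound (c / (a - b))); apply: archi_boundP.
  by rewrite divr_ge0 ?ltW.
have : (n%:R : R) < 2 ^+ n by rewrite -natrX ltr_nat ltn_expl.
move=> /(lt_trans cn); rewrite ltr_pdivrMr// => c2.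
have p2 : 0 < (2 : R) ^+ n by rewrite exprn_gt0.
have := h n; rewrite -lerBlDl ler_pdivlMr// mulrC => /(lt_le_trans c2).
by rewrite ltxx.
Qed.

(** A sequence whose steps halve converges, and the same limit satisfies the
    error bound for every admissible constant [c] at once.  This uniformity
    matters: the constant of the Picard iterates depends on the time horizon,
    whereas their limit must not. *)
Lemma halving_limit (a : nat -> R) (c0 : R) :
  (forall n, `|a n.+1 - a n| <= c0 / 2 ^+ n) ->
  exists l, forall c, (forall n, `|a n.+1 - a n| <= c / 2 ^+ n) ->
    forall n, `|l - a n| <= 2 * c / 2 ^+ n.
Proof.
move=> a0.
have half c n : c / 2 ^+ n = 2 * c / 2 ^+ n.+1 :> R.
  by rewrite exprS invfM; field; rewrite expf_eq0 pnatr_eq0 andbF.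
have steps c : (forall n, `|a n.+1 - a n| <= c / 2 ^+ n) ->
    forall n m, `|a (n + m)%N - a n| <= 2 * c / 2 ^+ n - 2 * c / 2 ^+ (n + m).
  move=> ac n; elim=> [|m IH]; first by rewrite addn0 !subrr normr0.
  rewrite addnS; have := ac (n + m)%N; have := half (2 * c) (n + m)%N.
  have := half c (n + m)%N; move: IH; rewrite !ler_norml.
  by move=> /andP[? ?] ? ? /andP[? ?]; apply/andP; split; lra.
have c0n m : 0 <= 2 * c0 / 2 ^+ m.
  by rewrite -[_ / _]mulrA mulr_ge0// (le_trans _ (a0 m)).
have far c : (forall n, `|a n.+1 - a n| <= c / 2 ^+ n) ->
    forall n m, `|a (n + m)%N - a n| <= 2 * c / 2 ^+ n.
  move=> ac n m; apply: le_trans (steps _ ac n m) _.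
  have : 0 <= c / 2 ^+ (n + m) by apply: le_trans (ac _).
  by rewrite -[2 * c / 2 ^+ (n + m)]mulrA; lra.
(* The intervals of centre a n and radius 2 * c0 / 2 ^+ n are nested; the limit
   is the supremum of their left ends. *)
pose lo n := a n - 2 * c0 / 2 ^+ n.
have lo_up n m : lo n <= a m + 2 * c0 / 2 ^+ m.
  have [/subnKC <-|/ltnW/subnKC <-] := leqP n m.
    have := steps _ a0 n (m - n)%N; rewrite ler_norml /lo => /andP[+ _].
    by have := c0n (n + (m - n))%N; lra.
  have := steps _ a0 m (n - m)%N; rewrite ler_norml /lo => /andP[_].
  by have := c0n (m + (n - m))%N; lra.
have lo_sup : has_sup (range lo).
  split; first by exists (lo 0%N), 0%N.
  by exists (a 0%N + 2 * c0 / 2 ^+ 0) => _ [n _ <-].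
exists (sup (range lo)) => c ac n; apply: (@le_of_halving _ _ (2 * (2 * c0))) => m.
have close : `|sup (range lo) - a (n + m)%N| <= 2 * c0 / 2 ^+ (n + m).
  rewrite ler_distl; apply/andP; split.
    by apply: ub_le_sup; [case: lo_sup|exists (n + m)%N].
  by apply: ge_sup; [case: lo_sup|move=> _ [k _ <-]].
have cm : 2 * c0 / 2 ^+ (n + m) <= 2 * (2 * c0) / 2 ^+ m.
  have := c0n m; rewrite exprD invfM => c0m.
  have : ((2 : R) ^+ n)^-1 <= 1 by rewrite invf_le1 ?exprn_ege1 ?exprn_gt0// ler1n.
  move=> /(ler_wpM2r c0m); rewrite mul1r.
  have -> : 2 * c0 * ((2 ^+ n)^-1 / 2 ^+ m) = (2 ^+ n)^-1 * (2 * c0 / 2 ^+ m) by ring.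
  rewrite -[2 * (2 * c0) / _]mulrA; lra.
have := far _ ac n m; move: close; rewrite !ler_norml.
by move=> /andP[? ?] /andP[? ?]; apply/andP; split; lra.
Qed.

End Halving.

Section DelayEquation.
Set Implicit Arguments.
Unset Strict Implicit.
Context {R : realType} (tau : R)
  (mu : {finite_measure set (measurableTypeR R) -> \bar R}).
Context (phi : R -> R) (L : R) (L_ge0 : 0 <= L)
  (phi_lipschitz : forall u v : R, `|phi u - phi v| <= L * `|u - v|).
Implicit Types (u v : R -> R) (t T B c : R) (n m : nat).

Lemma lipschitz_comp_continuous u : continuous u -> continuous (phi \o u).
Proof.
move=> cu t; apply: continuous_comp; first exact: cu.
apply/cvgrPdist_lt => e e0.
have L1 : 0 < L + 1 by rewrite ltr_wpDl.
near=> z; apply: le_lt_trans (phi_lipschitz _ _) _.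
apply: (@le_lt_trans _ _ ((L + 1) * `|u t - z|)).
  by rewrite ler_wpM2r// lerDl.
rewrite -ltr_pdivlMl//; near: z; apply/nbhs_ballP.
by exists ((L + 1)^-1 * e); rewrite /= ?mulr_gt0 ?invr_gt0.
Unshelve. all: by end_near. Qed.

Let rate u := delayed tau mu (phi \o u).
(* The right-hand side is Lipschitz with constant L times the mass; doubling it
   in the exponent is what turns one Picard step into a contraction by 1/2. *)
Let K := 2 * L * delay_mass tau mu.

Let mass_ge0 : 0 <= delay_mass tau mu. Proof. exact: fine_ge0. Qed.
Let K_ge0 : 0 <= K. Proof. by rewrite mulr_ge0// mulr_ge0. Qed.

Let is_derive_weight c t :
  is_derive t 1 (fun t => c * expR (K * t)) (c * (K * expR (K * t))).
Proof.
apply: is_deriveZ; rewrite mulrC.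
exact: (is_derive1_comp (is_derive_expR _) (is_derive_scale K t)).
Qed.

(** In one step, a distance [B expR (K t)] on the past of [t] produces a
    difference of rates of at most [K / 2 * B expR (K t)], which is the
    derivative of [B / 2 * expR (K t)].  Restricting to times before [T] avoids
    any growth assumption on the functions compared. *)
Let le_halved T u0 v0 u v B :
  continuous u0 -> continuous v0 -> continuous u -> continuous v -> 0 <= B ->
  (forall t, t <= 0 -> u t = v t) ->
  (forall t, 0 < t -> is_derive t 1 u (rate u0 t)) ->
  (forall t, 0 < t -> is_derive t 1 v (rate v0 t)) ->
  (forall t, t <= T -> `|u0 t - v0 t| <= B * expR (K * t)) ->
  forall t, t <= T -> u t - v t <= B / 2 * expR (K * t).
Proof.
move=> cu0 cv0 cu cv B0 uv Du Dv uv0 t tT.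
have E r : 0 <= B / 2 * expR (K * r).
  by rewrite mulr_ge0 ?expR_ge0// divr_ge0.
have [/uv ->|t0] := leP t 0; first by rewrite subrr E.
have := @le_increment _ (u \- v) (fun t => B / 2 * expR (K * t))
  (fun t => rate u0 t - rate v0 t) (fun t => B / 2 * (K * expR (K * t)))
  0 t (ltW t0) _ _ _ _ _.
rewrite /= (uv 0 (lexx _)) subrr subr0 => H; apply: le_trans (H _ _ _ _ _) _.
- by move=> s _; apply: continuousB; [exact: cu|exact: cv].
- by move=> s _; exact: is_derive_continuous (is_derive_weight _ _).
- by move=> s /andP[s0 _]; apply: is_deriveB; [exact: Du|exact: Dv].
- by move=> s _; exact: is_derive_weight.
- move=> s /andP[s0 st]; apply: le_trans (ler_norm _) _.
  have -> : B / 2 * (K * expR (K * s)) = L * (B * expR (K * s)) * delay_mass tau mu.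
    by rewrite /K; field.
  apply: norm_delay_integralB;
    try exact/continuous_translate/lipschitz_comp_continuous.
  move=> r /andP[_ r0] /=; apply: le_trans (phi_lipschitz _ _) _.
  rewrite ler_wpM2l//; apply: le_trans (uv0 _ _) _; first lra.
  by rewrite ler_wpM2l// ler_expR ler_wpM2l//; lra.
- by have := E 0; lra.
Qed.

Let contraction T u0 v0 u v B :
  continuous u0 -> continuous v0 -> continuous u -> continuous v -> 0 <= B ->
  (forall t, t <= 0 -> u t = v t) ->
  (forall t, 0 < t -> is_derive t 1 u (rate u0 t)) ->
  (forall t, 0 < t -> is_derive t 1 v (rate v0 t)) ->
  (forall t, t <= T -> `|u0 t - v0 t| <= B * expR (K * t)) ->
  forall t, t <= T -> `|u t - v t| <= B / 2 * expR (K * t).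
Proof.
move=> cu0 cv0 cu cv B0 uv Du Dv uv0 t tT.
rewrite ler_norml; apply/andP; split; last exact: (@le_halved T u0 v0).
rewrite lerNl opprB; apply: (@le_halved T v0 u0) => //.
- by move=> s /uv.
- by move=> s /uv0; rewrite distrC.
Qed.

Let initial_bound T u v : continuous u -> continuous v ->
  (forall t, t <= 0 -> u t = v t) ->
  exists2 B : R, 0 <= B & forall t, t <= T -> `|u t - v t| <= B * expR (K * t).
Proof.
move=> cu cv uv; have cuv : continuous (u \- v).
  by move=> t; apply: continuousB; [exact: cu|exact: cv].
have [B B0 uvB] := bounded_on_segment
  (@continuous_subspaceT _ _ `[0, T] _ cuv).
exists B => // t tT; have [t0|t0] := leP t 0.
  by rewrite (uv _ t0) subrr normr0 mulr_ge0 ?expR_ge0.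
have /le_trans : `|u t - v t| <= B by apply: uvB; rewrite (ltW t0).
by apply; rewrite ler_peMr// -expR0 ler_expR mulr_ge0// ltW.
Qed.

Lemma delay_equation_unique u v : continuous u -> continuous v ->
  (forall t, t <= 0 -> u t = v t) ->
  (forall t, 0 < t -> is_derive t 1 u (delayed tau mu (phi \o u) t)) ->
  (forall t, 0 < t -> is_derive t 1 v (delayed tau mu (phi \o v) t)) ->
  forall t, u t = v t.
Proof.
move=> cu cv uv Du Dv t; have [B B0 uvB] := initial_bound t cu cv uv.
have {}uvB n : forall s, s <= t -> `|u s - v s| <= B / 2 ^+ n * expR (K * s).
  elim: n => [|n IH]; first by rewrite expr0 divr1.
  have -> : B / 2 ^+ n.+1 = B / 2 ^+ n / 2 by rewrite exprSr invfM mulrA.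
  apply: contraction IH => //; by rewrite divr_ge0 ?exprn_ge0.
apply/eqP; rewrite -subr_eq0 -normr_le0.
apply: (@le_of_halving _ _ _ (B * expR (K * t))) => n.
by rewrite add0r mulrAC; exact: uvB.
Qed.

(** Picard iteration.  Local uniform convergence comes from the contraction on
    each horizon [T]; the limit is a fixed point because it and its image under
    one more step are both close to the iterates. *)
Lemma delay_equation_exists (psi : R -> R) : continuous psi ->
  exists u, [/\ continuous u, forall t, t <= 0 -> u t = psi t &
    forall t, 0 < t -> is_derive t 1 u (delayed tau mu (phi \o u) t)].
Proof.
move=> cpsi.
have step u : exists v, continuous u -> [/\ continuous v,
    forall t, t <= 0 -> v t = psi t & forall t, 0 < t -> is_derive t 1 v (rate u t)].
  have [cu|] := pselect (continuous u); last by exists psi.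
  have crate := delayed_continuous (tau := tau) (mu := mu)
    (lipschitz_comp_continuous cu).
  have [G cG DG] := primitive (-1) crate.
  (* The clamped arguments splice psi on the past and the primitive on the
     future, keeping the function continuous at 0. *)
  exists (fun t => psi (Num.min t 0) + (G (Num.max t 0) - G 0)) => _; split.
  - move=> t; apply: (@continuousD _ _ _ (fun t => psi (Num.min t 0))
        (fun t => G (Num.max t 0) - G 0)).
      apply: (@continuous_comp _ _ _ (fun t => Num.min t 0)); last exact: cpsi.
      exact: continuous_minr.
    apply: (@continuousB _ _ _ (fun t => G (Num.max t 0)) (fun=> G 0));
      last exact: cst_continuous.
    apply: (@continuous_comp _ _ _ (fun t => Num.max t 0)).
      exact: continuous_maxr.
    exact: cG.
  - by move=> t t0; rewrite (min_idPl t0) (max_idPr t0) subrr addr0.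
  - move=> t t0.
    have : is_derive t 1 (fun t => (psi 0 - G 0) + G t) (rate u t).
      have : is_derive t 1 G (rate u t) by apply: DG; lra.
      move=> /(is_deriveD (is_derive_cst (psi 0 - G 0) t (1 : R))).
      by rewrite add0r.
    apply: near_eq_is_derive; near=> z.
    have z0 : 0 <= z by apply: ltW; near: z; exact: lt_nbhsr.
    by rewrite (min_idPr z0) (max_idPl z0); ring.
have [S HS] := choice step.
pose x_ n := iter n S psi.
have cx n : continuous (x_ n) by elim: n => // n /HS[].
have x_psi n t : t <= 0 -> x_ n t = psi t.
  by case: n => // n t0; have [_ E _] := HS _ (cx n); exact: E.
have Dx n t : 0 < t -> is_derive t 1 (x_ n.+1) (rate (x_ n) t).
  by have [_ _ E] := HS _ (cx n); exact: E.
have bound T : exists2 B : R, 0 <= B & forall n t, t <= T ->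
    `|x_ n.+1 t - x_ n t| <= B / 2 ^+ n * expR (K * t).
  have [|B B0 xB] := @initial_bound T (x_ 1%N) (x_ 0%N) (cx _) (cx _).
    by move=> t t0; rewrite !x_psi.
  exists B => //; elim=> [|n IH]; first by rewrite expr0 divr1.
  have -> : B / 2 ^+ n.+1 = B / 2 ^+ n / 2 by rewrite exprSr invfM mulrA.
  apply: contraction IH => //; try exact: Dx.
    by rewrite divr_ge0 ?exprn_ge0.
  by move=> t t0; rewrite !x_psi.
have lim t : exists l, forall c,
    (forall n, `|x_ n.+1 t - x_ n t| <= c / 2 ^+ n) ->
    forall n, `|l - x_ n t| <= 2 * c / 2 ^+ n.
  have [B B0 xB] := bound t.
  apply: (@halving_limit _ (x_^~ t) (B * expR (K * t))) => n.
  by rewrite mulrAC; exact: xB.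
have [x xE] := choice lim.
have dist T : exists2 B : R, 0 <= B & forall n t, t <= T ->
    `|x t - x_ n t| <= B / 2 ^+ n * expR (K * t).
  have [B B0 xB] := bound T; exists (2 * B) => [|n t tT]; first by rewrite mulr_ge0.
  rewrite mulrAC -[2 * B * _]mulrA; apply: xE => m; rewrite mulrAC; exact: xB.
have triangle (a b c d e : R) :
    `|a - b| <= e / 3 -> `|d - c| <= e / 3 -> `|b - c| <= e / 3 -> `|a - d| <= e.
  rewrite !ler_norml => /andP[? ?] /andP[? ?] /andP[? ?].
  by apply/andP; split; lra.
have cxl : continuous x.
  move=> t; have [B B0 xB] := dist (t + 1).
  apply/cvgrPdist_le => e e0.
  have [n Bn] : exists n, B * expR (K * (t + 1)) / 2 ^+ n <= e / 3.
    apply: contrapT => /forallNP nB.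
    have : e / 3 <= 0.
      apply: (@le_of_halving _ _ _ (B * expR (K * (t + 1)))) => n.
      by rewrite add0r leNgt; apply/negP => /ltW; exact: nB.
    lra.
  have unif z : z <= t + 1 -> `|x z - x_ n z| <= e / 3.
    move=> zt; apply: le_trans (xB n z zt) _; apply: le_trans Bn.
    rewrite mulrAC ler_wpM2r ?invr_ge0 ?exprn_ge0// ler_wpM2l// ler_expR.
    by rewrite ler_wpM2l.
  near=> z.
  have zt : z <= t + 1.
    by near: z; apply: lt_le_nbhsl; rewrite ltrDl.
  have xz : `|x_ n t - x_ n z| <= e / 3.
    near: z; move/cvgrPdist_le: (cx n t); apply; lra.
  have xt : t <= t + 1 by lra.
  exact: triangle (unif t xt) (unif z zt) xz.
have [cv vpsi Dv] := HS _ cxl.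
suff vx : S x = x by rewrite vx in cv vpsi Dv; exists x.
apply/funext => t; have [B B0 xB] := dist t.
apply/eqP; rewrite -subr_eq0 -normr_le0.
apply: (@le_of_halving _ _ _ (B * expR (K * t))) => n.
have v_x : `|S x t - x_ n.+1 t| <= B / 2 ^+ n / 2 * expR (K * t).
  apply: (contraction (T := t) (u0 := x) (v0 := x_ n)) => //.
  - by rewrite divr_ge0 ?exprn_ge0.
  - by move=> s s0; rewrite vpsi// x_psi.
  all: try exact: Dx.
  exact: xB.
have := xB n.+1 t (lexx _); move: v_x.
have -> : B / 2 ^+ n.+1 = B / 2 ^+ n / 2 by rewrite exprSr invfM mulrA.
rewrite [B * _ / _]mulrAC !ler_norml.
by move=> /andP[? ?] /andP[? ?]; apply/andP; split; lra.
Unshelve. all: by end_near. Qed.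

End DelayEquation.

(** * Well-posedness for a positive initial history *)

Section WellPosed.
Set Implicit Arguments.
Unset Strict Implicit.
Context {R : realType}.
Implicit Types (t u v : R).

Context (f : R -> R)
    (f_derivable : forall u : R, 0 < u -> derivable f u 1)
    (f'_continuous : forall u : R, 0 < u -> {for u, continuous f^`()})
    (f_gt0 : forall u : R, 0 < u -> 0 < f u)
    (f'_cvg0 : f^`() u @[u --> +oo] --> 0).

Lemma half_line_is_derive (u : R) : 0 < u -> is_derive u 1 f (f^`() u).
Proof. by move=> u0; rewrite derive1E; exact/derivableP/f_derivable. Qed.

Lemma half_line_continuous (u : R) : 0 < u -> {for u, continuous f}.
Proof. by move=> /half_line_is_derive/is_derive_continuous. Qed.

Lemma derivative_small (e : R) : 0 < e -> exists2 N : R, 0 < N &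
  forall u, N <= u -> `|f^`() u| <= e.
Proof.
move=> e0; have : \forall u \near +oo, `|f^`() u| <= e.
  move/cvgrPdist_le : f'_cvg0 => /(_ _ e0); apply: filterS => u.
  by rewrite sub0r normrN.
move=> [N [_ h]]; exists (Num.max N 0 + 1).
  by rewrite ltr_wpDl// le_max lexx orbT.
move=> u Nu; apply: h; apply: lt_le_trans Nu.
by apply: (@le_lt_trans _ _ (Num.max N 0)); rewrite ?le_max ?lexx// ltrDl.
Qed.

(** [f'] is bounded on [[m, +oo[]: by continuity on a segment and by its limit
    0 beyond. *)
Lemma cutoff_lipschitz (m : R) : 0 < m -> exists2 L : R, 0 <= L & forall u v,
  `|f (Num.max u m) - f (Num.max v m)| <= L * `|u - v|.
Proof.
move=> m0; have [N N0 hN] := derivative_small ltr01.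
have cf' : {within `[m, N], continuous f^`()}.
  apply: within_segment => t /andP[mt _]; apply: f'_continuous.
  exact: lt_le_trans mt.
have [B B0 hB] := bounded_on_segment cf'.
have f'L u : m <= u -> `|f^`() u| <= B + 1.
  move=> mu; have [uN|/ltW Nu] := leP u N.
    by rewrite (le_trans (hB _ _)) ?mu ?uN// lerDl.
  by rewrite (le_trans (hN _ Nu))// lerDr.
exists (B + 1); first by rewrite addr_ge0.
suff H u v : u <= v -> `|f (Num.max v m) - f (Num.max u m)| <= (B + 1) * (v - u).
  move=> u v; have [uv|/ltW vu] := leP u v.
    by rewrite distrC [`|u - v|]distrC [`|v - u|]ger0_norm ?subr_ge0//; exact: H.
  by rewrite [`|u - v|]ger0_norm ?subr_ge0//; exact: H.
move=> uv.
have max_uv : Num.max v m - Num.max u m <= v - u.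
  by case: (leP v m); case: (leP u m); lra.
have : Num.max u m <= Num.max v m by rewrite ge_max !le_max uv lexx orbT.
rewrite le_eqVlt => /predU1P[->|uvm].
  by rewrite subrr normr0 mulr_ge0 ?subr_ge0 ?addr_ge0.
have mum : m <= Num.max u m by rewrite le_max lexx orbT.
have [||r /andP[ur _] ->] := @mean_value _ f f^`() _ _ uvm.
- move=> t /andP[ut _]; apply: half_line_continuous.
  by rewrite (lt_le_trans m0)// (le_trans mum).
- move=> t /andP[ut _]; apply: half_line_is_derive.
  by rewrite (lt_le_trans m0)// (le_trans mum)// ltW.
rewrite normrM ler_pM// ?f'L ?(le_trans mum (ltW ur))//.
by rewrite ger0_norm// subr_ge0 ltW.
Qed.

Context (tau : R) (tau_gt0 : 0 < tau)
    (mu : {finite_measure set (measurableTypeR R) -> \bar R})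
    (psi : R -> R) (psi_continuous : {within `[- tau, 0], continuous psi})
    (psi_gt0 : forall t : R, - tau <= t <= 0 -> 0 < psi t).

Lemma delay_integral_ge0 (h : R -> R) :
  (forall s, - tau <= s <= 0 -> 0 <= h s) -> 0 <= delay_integral tau mu h.
Proof. by move=> h0; apply: Rintegral_ge0 => s /=; rewrite in_itv/=; exact: h0. Qed.

(** Before the first time [s] at which [y] would reach a level [c < m], all
    delayed values are positive, so [y] is nondecreasing on [[0, s]] and
    [y s >= y 0 >= m > c].  This bootstraps positivity, without which nothing is
    known of [f (y (t + s))]. *)
Lemma solution_ge (y : R -> R) (m : R) : 0 < m ->
  (forall t, - tau <= t <= 0 -> m <= psi t) ->
  is_solution tau mu f psi y -> forall t, - tau <= t -> m <= y t.
Proof.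
move=> m0 m_psi [cy Dy ypsi] t1 t1tau.
have [t10|t10] := leP t1 0; first by rewrite ypsi ?m_psi ?t1tau.
rewrite leNgt; apply/negP => yt1.
(* Half of m keeps the level c positive even if y t1 is negative. *)
pose c := Num.max (y t1) (m / 2).
have cm : c < m by rewrite gt_max yt1; lra.
have c0 : 0 < c by rewrite lt_max; apply/orP; right; lra.
pose z t := y (Num.max t (- tau)).
have zy t : - tau <= t -> z t = y t by move=> /max_idPl; rewrite /z => ->.
have cz : continuous z by exact: ray_extension_continuous.
pose low := [set t | 0 <= t <= t1 /\ y t <= c].
have low1 : low t1 by split; [rewrite lexx ltW|rewrite /c le_max lexx].
have low_inf : has_inf low.
  by split; [exists t1|exists 0 => t [/andP[]]].
set s := inf low.
have s0 : 0 <= s by apply: lb_le_inf; [exists t1|move=> t [/andP[]]].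
have s_le t : low t -> s <= t by move=> lt; apply: ge_inf => //; case: low_inf.
have above t : 0 <= t < s -> c < y t.
  move=> /andP[t0 ts]; rewrite ltNge; apply/negP => ytc.
  have tt1 : t <= t1 by rewrite ltW// (lt_le_trans ts)// s_le.
  by have := s_le t; rewrite leNgt ts => /(_ (conj _ ytc)); rewrite t0 tt1 => /(_ isT).
have tau0 : - tau <= 0 by rewrite oppr_le0 ltW.
have ys : m <= y s.
  have z0s : z 0 <= z s.
    apply: (@nondecreasing_increment _ z
      (fun t => delay_integral tau mu (fun r => f (y (t + r)))) 0 s s0).
    - by move=> t _; exact: cz.
    - move=> t /andP[t0 _]; apply: near_eq_is_derive (Dy _ t0).
      near=> r; rewrite zy//; apply: ltW; near: r; apply: lt_nbhsr.
      by rewrite (lt_trans _ t0)// oppr_lt0.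
    - move=> t /andP[t0 ts]; apply: delay_integral_ge0 => r /andP[r1 r2].
      have t0' : 0 < t := t0.
      have ts' : t < s := ts.
      apply/ltW/f_gt0; have [tr0|tr0] := leP (t + r) 0.
        by rewrite ypsi ?psi_gt0//; apply/andP; lra.
      by apply: (lt_trans c0); apply: above; apply/andP; split; lra.
  have y0 : m <= y 0 by rewrite ypsi ?m_psi ?tau0 ?lexx.
  by rewrite (le_trans y0)// -!zy// (le_trans tau0).
have : \forall t \near s, c < z t.
  move: (cz s) => /cvgr_gt; apply; rewrite zy ?(lt_le_trans cm)//.
  exact: le_trans tau0 s0.
move=> /nbhs_ballP[d /= d0 dz].
have [t lt ts] := inf_adherent d0 low_inf.
have st : s <= t by exact: s_le.
have : c < z t.
  by apply: dz; rewrite /ball/= distrC ger0_norm ?subr_ge0// ltrBlDl.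
by rewrite zy ?(le_trans tau0) ?(le_trans s0)//; case: lt => _; rewrite leNgt => /negP.
Unshelve. all: by end_near. Qed.

(** The solution is exhibited on the whole line, extended constantly to the left
    of [- tau], so that it is continuous everywhere. *)
Lemma delay_well_posed : exists x : R -> R, exists2 m : R, 0 < m &
  [/\ continuous x, forall t, m <= x t,
      forall t, 0 < t -> is_derive t 1 x (delayed tau mu (f \o x) t),
      is_solution tau mu f psi x
    & forall y, is_solution tau mu f psi y -> forall t, - tau <= t -> y t = x t].
Proof.
have tau0 : - tau <= 0 by rewrite oppr_le0 ltW.
have [t0 t0tau m_psi'] := EVT_min tau0 psi_continuous.
set m := psi t0 in m_psi'.
have m_psi t : - tau <= t <= 0 -> m <= psi t.
  by move=> tt; apply: m_psi'; rewrite in_itv.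
have m0 : 0 < m by apply: psi_gt0; rewrite in_itv/= in t0tau.
have [L L0 HL] := cutoff_lipschitz m0.
pose clamp t := Num.max (Num.min t 0) (- tau).
have cclamp : continuous clamp.
  move=> t; apply: (@continuous_comp _ _ _ (fun t : R => Num.min t 0)
    (fun t : R => Num.max t (- tau))).
    exact: continuous_minr.
  exact: continuous_maxr.
have clampP t : - tau <= clamp t <= 0.
  by rewrite /clamp le_max lexx orbT ge_max ge_min lexx orbT tau0.
have clampE t : - tau <= t <= 0 -> clamp t = t.
  by move=> /andP[t1 t2]; rewrite /clamp (min_idPl t2) (max_idPl t1).
have cpsi : continuous (psi \o clamp).
  by apply: within_comp_continuous psi_continuous cclamp _ => t; rewrite /= in_itv/=.
have [x [cx xpsi Dx]] := delay_equation_exists tau mu L0 HL cpsi.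
have max0 u : 0 < Num.max u m by rewrite lt_max m0 orbT.
have xm t : m <= x t.
  have [t_le0|t_gt0] := leP t 0.
    by rewrite xpsi//= m_psi.
  have m0x : m <= x 0 by rewrite xpsi//= m_psi.
  apply: le_trans m0x _.
  apply: (nondecreasing_increment (ltW t_gt0)).
  - by move=> s _; exact: cx.
  - by move=> s /andP[s0 _]; exact: Dx.
  - by move=> s _; apply: delay_integral_ge0 => r _; apply/ltW/f_gt0.
have cutE : (fun u => f (Num.max u m)) \o x = f \o x.
  by apply/funext => t /=; rewrite (max_idPl (xm t)).
exists x, m => //; split => //.
- by move=> t tt; rewrite -cutE; exact: Dx.
- split; first exact: continuous_subspaceT.
  + by move=> t tt; have := Dx t tt; rewrite cutE.
  + by move=> t tt; rewrite xpsi/= ?clampE//; case/andP: tt.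
- move=> y sy; have ym := solution_ge m0 m_psi sy; case: sy => cy Dy ypsi.
  pose z t := y (Num.max t (- tau)).
  have zy t : - tau <= t -> z t = y t by move=> /max_idPl; rewrite /z => ->.
  have cz : continuous z by exact: ray_extension_continuous.
  suff zx t : z t = x t by move=> t tt; rewrite -zx zy.
  apply: (delay_equation_unique L0 HL cz cx _ _ Dx) => {}t tt.
    rewrite xpsi//= /z /clamp (min_idPl tt) ypsi// le_max lexx orbT ge_max tt.
    by rewrite tau0.
  have -> : delayed tau mu ((fun u => f (Num.max u m)) \o z) t =
      \int[mu]_(s in `[- tau, 0]) f (y (t + s)).
    apply: eq_delay_integral => s /andP[s1 s2] /=.
    have ts : - tau <= t + s by lra.
    by rewrite zy// (max_idPl (ym _ ts)).
  apply: near_eq_is_derive (Dy _ tt).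
  near=> r; rewrite zy//; apply: ltW; near: r; apply: lt_nbhsr.
  by rewrite (lt_le_trans _ (ltW tt))// oppr_lt0.
Unshelve. all: by end_near. Qed.

End WellPosed.

(** * What the delay costs on the time scale *)

Section DelayCost.
Set Implicit Arguments.
Unset Strict Implicit.
Context {R : realType}.
Implicit Types (t u v s r c : R).

Context (f : R -> R)
    (f_derivable : forall u : R, 0 < u -> derivable f u 1)
    (f_gt0 : forall u : R, 0 < u -> 0 < f u)
    (f'_gt0 : exists x1 : R, forall u : R, x1 < u -> 0 < f^`() u)
    (f'_cvg0 : f^`() u @[u --> +oo] --> 0).

Let Df u : 0 < u -> is_derive u 1 f (f^`() u).
Proof. exact: half_line_is_derive. Qed.

Lemma f_eventually_nondecreasing : exists2 X : R, 0 < X &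
  (forall u, X <= u -> 0 < f^`() u) /\
  forall u v, X <= u -> u <= v -> f u <= f v.
Proof.
have [x1 f'0] := f'_gt0.
have X0 : 0 < Num.max x1 0 + 1 by rewrite ltr_wpDl// le_max lexx orbT.
have Xf' u : Num.max x1 0 + 1 <= u -> 0 < f^`() u.
  move=> Xu; apply/f'0/(lt_le_trans _ Xu); rewrite ltr_pwDr//.
  by rewrite le_max lexx.
exists (Num.max x1 0 + 1) => //; split=> // u v Xu uv.
have u0 := lt_le_trans X0 Xu.
apply: (@nondecreasing_increment _ f f^`() u v uv) => t /andP[ut _].
- exact/half_line_continuous/lt_le_trans/ut.
- exact/Df/lt_trans/ut.
- by apply/ltW/Xf'/(le_trans Xu)/ltW.
Qed.

(** [f] is positive on a segment and nondecreasing beyond it. *)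
Lemma f_bounded_below (m : R) : 0 < m ->
  exists2 c : R, 0 < c & forall u, m <= u -> c <= f u.
Proof.
move=> m0; have [X X0 [_ fX]] := f_eventually_nondecreasing.
have mX : m <= Num.max m X by rewrite le_max lexx.
have cf : {within `[m, Num.max m X], continuous f}.
  apply: within_segment => t /andP[mt _]; apply: half_line_continuous => //.
  exact: lt_le_trans mt.
have [u0 u0m fmin] := EVT_min mX cf.
exists (f u0) => [|u mu].
  by apply: f_gt0; apply: lt_le_trans m0 _; move: u0m; rewrite in_itv/= => /andP[].
have [uX|/ltW Xu] := leP u (Num.max m X).
  by apply: fmin; rewrite in_itv/= mu.
apply: (@le_trans _ _ (f (Num.max m X))).
  by apply: fmin; rewrite in_itv/= mX lexx.
by apply: fX Xu; rewrite le_max lexx orbT.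
Qed.

Context (tau : R) (tau_gt0 : 0 < tau)
    (mu : {finite_measure set (measurableTypeR R) -> \bar R})
    (mass_gt0 : 0 < delay_mass tau mu)
    (m : R) (m_gt0 : 0 < m)
    (x : R -> R) (x_continuous : continuous x) (x_ge : forall t, m <= x t)
    (x_derive : forall t, 0 < t ->
      is_derive t 1 x (delayed tau mu (f \o x) t)).

Let M := delay_mass tau mu.
Let x_gt0 t : 0 < x t. Proof. exact: lt_le_trans (x_ge t). Qed.
Let fx_gt0 t : 0 < f (x t). Proof. exact: f_gt0. Qed.

Let fx_continuous : continuous (f \o x).
Proof.
move=> t; apply: continuous_comp; first exact: x_continuous.
exact: half_line_continuous.
Qed.

Lemma solution_nondecreasing u v : 0 <= u -> u <= v -> x u <= x v.
Proof.
move=> u0 uv; apply: (nondecreasing_increment uv).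
- by move=> t _; exact: x_continuous.
- by move=> t /andP[ut _]; apply: x_derive; exact: le_lt_trans ut.
- by move=> t _; apply: delay_integral_ge0 => r _; exact/ltW/fx_gt0.
Qed.

(** [x' >= c M] for a positive lower bound [c] of [f] on [[m, +oo[]. *)
Lemma solution_unbounded (A : R) :
  exists2 T : R, 0 <= T & forall t, T <= t -> A <= x t.
Proof.
have [c c0 fc] := f_bounded_below m_gt0.
have cM : 0 < c * M by rewrite mulr_gt0.
exists (Num.max 0 ((A - x 0) / (c * M))); first by rewrite le_max lexx.
move=> t; rewrite ge_max ler_pdivrMr// => /andP[t0 At].
have : c * M * t - c * M * 0 <= x t - x 0.
  apply: (@le_increment _ (fun s : R => c * M * s) x (fun=> c * M)
    (delayed tau mu (f \o x)) 0 t t0).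
  - by move=> s _; exact: is_derive_continuous (is_derive_scale _ _).
  - by move=> s _; exact: x_continuous.
  - by move=> s _; exact: is_derive_scale.
  - by move=> s /andP[s0 _]; exact: x_derive.
  - move=> s _; rewrite -delay_integral_cst; apply: le_delay_integral.
    + exact: cst_continuous.
    + exact: continuous_translate.
    + by move=> r _; exact: fc.
rewrite mulr0 subr0 => h.
rewrite -(lerD2r (- x 0)) (le_trans At)//.
by rewrite mulrC.
Qed.

Let phi t := ln (f (x t)).

Let phi_continuous : continuous phi.
Proof.
move=> t; apply: (@continuous_comp _ _ _ (f \o x) (@ln R)).
  exact: fx_continuous.
exact: is_derive_continuous (is_derive1_ln (fx_gt0 t)).
Qed.

Let dphi t := (f (x t))^-1 * (f^`()%classic (x t) * delayed tau mu (f \o x) t).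

Let phi_derive t : 0 < t -> is_derive t 1 phi (dphi t).
Proof.
move=> t0; have D1 := is_derive1_comp (Df (x_gt0 t)) (x_derive t0).
exact: (@is_derive1_comp _ (@ln R) (f \o x) t _ _ (is_derive1_ln (fx_gt0 t)) D1).
Qed.

(** [phi' = f'(x) x' / f(x) <= M f'(x)], as [x' <= M f(x)] once [f] is
    nondecreasing on the past values of [x]. *)
Let phi_increment (e : R) : 0 < e -> exists2 T : R, 0 <= T &
  forall t s, T <= t -> - tau <= s <= 0 -> 0 <= phi t - phi (t + s) <= e.
Proof.
move=> e0; have [X X0 [f'X fX]] := f_eventually_nondecreasing.
have [N N0 hN] := derivative_small f'_cvg0 (divr_gt0 e0 (mulr_gt0 tau_gt0 mass_gt0)).
have [T T0 hT] := solution_unbounded (Num.max X N).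
have TX r : T <= r -> X <= x r.
  by move=> /hT; apply: le_trans; rewrite le_max lexx.
have TN r : T <= r -> N <= x r.
  by move=> /hT; apply: le_trans; rewrite le_max lexx orbT.
have tau0 := ltW tau_gt0.
(* One tau keeps the delayed time t + s beyond T; the second one does so for the
   times seen from t + s. *)
exists (T + tau + tau); first by rewrite !addr_ge0.
move=> t s Tt /andP[s1 s2].
have ts : t + s <= t by rewrite gerDl.
have Tts : T + tau <= t + s.
  by rewrite -[T + tau](addrK tau) lerD.
have phi'ge0 r : t + s < r < t ->
    0 <= dphi r.
  move=> /andP[sr _]; rewrite /dphi mulr_ge0 ?invr_ge0 ?(ltW (fx_gt0 _))// mulr_ge0//.
    apply/ltW/f'X/TX/(le_trans _ (ltW sr))/(le_trans _ Tts).
    by rewrite lerDl.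
  by apply: delay_integral_ge0 => z _; exact/ltW/fx_gt0.
have r0 r : t + s < r -> 0 < r.
  by apply: le_lt_trans; apply: le_trans Tts; rewrite addr_ge0.
rewrite subr_ge0; apply/andP; split.
  apply: (nondecreasing_increment (du := dphi) ts) => // r.
  - by move=> _; exact: phi_continuous.
  - by move=> /andP[sr _]; apply/phi_derive/r0.
move: s2; rewrite le_eqVlt => /predU1P[->|s2]; first by rewrite addr0 subrr ltW.
have ts' : t + s < t by rewrite gtrDl.
have [r|r /andP[sr _]|r /andP[sr rt] ->] := @mean_value _ phi dphi _ _ ts'.
- by move=> _; exact: phi_continuous.
- exact/phi_derive/r0/sr.
have slope : dphi r <= e / tau.
  have Tr : T + tau <= r by rewrite (le_trans Tts)// ltW.
  have Tr' : T <= r by apply: le_trans Tr; rewrite lerDl.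
  rewrite /dphi ler_pdivrMl//.
  have -> : f (x r) * (e / tau) = e / (tau * M) * (f (x r) * M).
    by field; rewrite !gt_eqF.
  rewrite ler_pM//.
  - exact/ltW/f'X/TX.
  - by apply: delay_integral_ge0 => z _; exact/ltW/fx_gt0.
  - exact/(le_trans (ler_norm _))/hN/TN.
  - rewrite -delay_integral_cst; apply: le_delay_integral.
    + exact: continuous_translate.
    + exact: cst_continuous.
    + move=> z /andP[z1 z2] /=.
      have Trz : T <= r + z by rewrite -[T](addrK tau) lerD.
      apply: fX; first exact: TX.
      by apply: solution_nondecreasing; [exact: le_trans Trz|rewrite gerDl].
apply: (@le_trans _ _ (e / tau * tau)); last by rewrite divfK ?gt_eqF.
rewrite ler_pM//.
- by apply: phi'ge0; rewrite sr.
- by rewrite subr_ge0.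
- by rewrite opprD addrA subrr add0r lerNl.
Qed.

Context (G : R -> R) (G_derive : forall u, 1 <= u -> is_derive u 1 G (f u)^-1).

Let C := delay_integral tau mu Num.Def.normr.

(** The cost of the delay on the time scale: [M t - G (x t)] is [C ln (f (x t))]
    up to a relative error [e] and an additive constant. *)
Lemma delay_cost_asymptotics (e : R) : 0 < e -> e < 1 ->
  exists K T : R, forall t, T <= t ->
  (1 - e) * (C * ln (f (x t))) - K <= M * t - G (x t) <= C * ln (f (x t)) + K.
Proof.
move=> e0 e1; have [T1 T10 hT1] := phi_increment e0.
have [T2 T20 hT2] := solution_unbounded 1.
pose T := T1 + T2; have T0 : 0 <= T by rewrite addr_ge0.
have [Phi cPhi DPhi] := primitive (- 2 - tau) phi_continuous.
have cdPhi := delayed_continuous (tau := tau) (mu := mu) cPhi.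
(* Q' = q; the factor 1 gives both the shape expected by is_derive_comb. *)
pose q t := M * phi t - 1 * delayed tau mu phi t.
pose Q t := M * Phi t - 1 * delayed tau mu Phi t.
have cphit t : continuous (fun s => phi (t + s)) by exact: continuous_translate.
have cphi0 t : continuous (fun _ : R => phi t) by exact: cst_continuous.
have cgap t : continuous (fun s => phi t - phi (t + s)).
  exact: continuous_diff.
have qE t : q t = delay_integral tau mu (fun s => phi t - phi (t + s)).
  by rewrite delay_integralB// delay_integral_cst /q mul1r mulrC.
have linE c t : M - c * q t =
    delay_integral tau mu (fun s => 1 - c * (phi t - phi (t + s))).
  rewrite delay_integralB; last 2 first.
  - exact: cst_continuous.
  - exact: continuous_scaled.
  by rewrite delay_integral_cst mul1r delay_integralZ// qE.
have clin c t : continuous (fun s => 1 - c * (phi t - phi (t + s))).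
  by apply: continuous_diff; [exact: cst_continuous|exact: continuous_scaled].
have rateE t : (f (x t))^-1 * delayed tau mu (f \o x) t =
    delay_integral tau mu (fun s => expR (- (phi t - phi (t + s)))).
  rewrite -delay_integralZ; last exact: continuous_translate.
  apply: eq_delay_integral => s _ /=.
  by rewrite opprB expRD expRN /phi !lnK ?posrE// mulrC.
have cexp t : continuous (fun s => expR (- (phi t - phi (t + s)))).
  move=> s; apply: (@continuous_comp _ _ _ (fun s => - (phi t - phi (t + s)))).
    by apply: continuousN; exact: cgap.
  exact: continuous_expR.
(* From expR (- y) <= 1 / (1 + y). *)
have expR_le (y : R) : 0 <= y <= e -> expR (- y) <= 1 - (1 - e) * y.
  move=> /andP[y0 ye]; have := expR_ge1Dx y; have : 0 < 1 + y by rewrite ltr_pwDl.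
  move=> y1 ey; rewrite expRN; apply: (@le_trans _ _ (1 + y)^-1).
    by rewrite lef_pV2 ?posrE ?expR_gt0.
  rewrite -[leLHS]mul1r ler_pdivrMr//.
  have : 0 <= (e - y) * y by rewrite mulr_ge0// subr_ge0.
  have : 0 <= e * y * y by rewrite !mulr_ge0// ltW.
  have : 0 <= (1 - e) * y by rewrite mulr_ge0// subr_ge0 ltW.
  nra.
have TT1 t : T < t -> T1 <= t by move=> /ltW; apply: le_trans; rewrite lerDl.
have TT2 t : T <= t -> T2 <= t by apply: le_trans; rewrite lerDr.
have rate_ge t : T < t -> M - 1 * q t <= (f (x t))^-1 * delayed tau mu (f \o x) t.
  move=> Tt; rewrite linE rateE; apply: le_delay_integral => // s st.
  by rewrite mul1r; exact: expR_ge1Dx.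
have rate_le t : T < t ->
    (f (x t))^-1 * delayed tau mu (f \o x) t <= M - (1 - e) * q t.
  move=> Tt; rewrite linE rateE; apply: le_delay_integral => // s st.
  by apply: expR_le; apply: hT1 => //; exact: TT1.
have DGx t : T < t -> is_derive t 1 (G \o x) ((f (x t))^-1 * delayed tau mu (f \o x) t).
  move=> Tt; apply: is_derive1_comp; first exact/G_derive/hT2/TT2/ltW.
  by apply: x_derive; exact: le_lt_trans Tt.
have cGx t : T <= t -> {for t, continuous (G \o x)}.
  move=> Tt; apply: continuous_comp; first exact: x_continuous.
  exact/is_derive_continuous/G_derive/hT2/TT2.
have DQ t : T < t -> is_derive t 1 Q (q t).
  move=> Tt; have t0 : 0 < t by exact: le_lt_trans Tt.
  apply: is_derive_comb; first by apply: DPhi; have := tau_gt0; lra.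
  apply: delayed_derive => // z tz; apply: DPhi.
  by apply: lt_le_trans tz; lra.
have cQ : continuous Q.
  by apply: continuous_diff; exact: continuous_scaled.
have Dlin c t : T < t -> is_derive t 1 (fun t => M * t - c * Q t) (M - c * q t).
  move=> Tt; have := is_derive_comb M c (is_derive_id t (1 : R)) (DQ _ Tt).
  by rewrite mulr1.
have clinQ c : continuous (fun t => M * t - c * Q t).
  apply: continuous_diff; apply: continuous_scaled => // t; exact: cvg_id.
have Phi_gap t s : T < t -> - tau <= s <= 0 ->
    (phi t - e) * `|s| <= Phi t - Phi (t + s) <= phi t * `|s|.
  move=> Tt /andP[s1]; rewrite le_eqVlt => /predU1P[->|s2].
    by rewrite normr0 addr0 subrr !mulr0 lexx.
  have t0 : 0 < t by exact: le_lt_trans Tt.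
  have ts' : t + s < t by rewrite gtrDl.
  have [r _|r /andP[sr _]|r /andP[sr rt] ->] := @mean_value _ Phi phi _ _ ts'.
  - exact: cPhi.
  - by apply: DPhi; apply: lt_trans sr; have := tau_gt0; lra.
  have -> : t - (t + s) = `|s| by rewrite ltr0_norm// opprD addrA subrr add0r.
  have : - tau <= r - t <= 0.
    by apply/andP; split; [rewrite lerBrDr (le_trans _ (ltW sr))// addrC lerD2l|
      rewrite subr_le0 ltW].
  move=> /(hT1 _ _ (TT1 _ Tt)); rewrite addrCA subrr addr0 => /andP[h1 h2].
  by apply/andP; split; rewrite ler_wpM2r//; lra.
have cabs : continuous (@Num.Def.normr R R) by exact: norm_continuous.
have QE t : Q t = delay_integral tau mu (fun s => Phi t - Phi (t + s)).
  rewrite delay_integralB ?delay_integral_cst /Q ?mul1r 1?mulrC//.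
    exact: cst_continuous.
  exact: continuous_translate.
have cPgap t : continuous (fun s => Phi t - Phi (t + s)).
  by apply: continuous_diff; [exact: cst_continuous|exact: continuous_translate].
have cZabs c : continuous (fun s : R => c * `|s|).
  exact: continuous_scaled.
have Q_le t : T < t -> Q t <= phi t * C.
  move=> Tt; rewrite QE -delay_integralZ//; apply: le_delay_integral => // s st.
  by have /andP[] := Phi_gap _ _ Tt st.
have Q_ge t : T < t -> (phi t - e) * C <= Q t.
  move=> Tt; rewrite QE -delay_integralZ//; apply: le_delay_integral => // s st.
  by have /andP[] := Phi_gap _ _ Tt st.
have C0 : 0 <= C by apply: delay_integral_ge0.
exists (`|M * T - 1 * Q T - G (x T)| + `|M * T - (1 - e) * Q T - G (x T)| + C), (T + 1).
move=> t Tt1; have Tt : T < t by apply: lt_le_trans Tt1; rewrite ltrDl.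
have Tr r : T <= r <= t -> T <= r by case/andP.
have lower : M * t - 1 * Q t - (M * T - 1 * Q T) <= G (x t) - G (x T).
  apply: (@le_increment _ (fun t => M * t - 1 * Q t) (G \o x) (fun t => M - 1 * q t)
    _ T t (ltW Tt)).
  - by move=> r _; exact: clinQ.
  - by move=> r /Tr; exact: cGx.
  - by move=> r /andP[Tr' _]; exact: Dlin.
  - by move=> r /andP[Tr' _]; exact: DGx.
  - by move=> r /andP[Tr' _]; exact: rate_ge.
have upper : G (x t) - G (x T) <= M * t - (1 - e) * Q t - (M * T - (1 - e) * Q T).
  apply: (@le_increment _ (G \o x) (fun t => M * t - (1 - e) * Q t) _
    (fun t => M - (1 - e) * q t) T t (ltW Tt)).
  - by move=> r /Tr; exact: cGx.
  - by move=> r _; exact: clinQ.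
  - by move=> r /andP[Tr' _]; exact: DGx.
  - by move=> r /andP[Tr' _]; exact: Dlin.
  - by move=> r /andP[Tr' _]; exact: rate_le.
have := Q_le _ Tt; have := Q_ge _ Tt; rewrite -/(phi t).
have := ler_norm (M * T - 1 * Q T - G (x T)).
have := ler_norm (- (M * T - (1 - e) * Q T - G (x T))).
rewrite normrN.
have := normr_ge0 (M * T - 1 * Q T - G (x T)).
have := normr_ge0 (M * T - (1 - e) * Q T - G (x T)).
move: lower upper.
move: `|M * T - 1 * Q T - G (x T)| `|M * T - (1 - e) * Q T - G (x T)| => K1 K2.
move=> lower upper K10 K20 K2h K1h Qge Qle.
have Qge' : (1 - e) * ((phi t - e) * C) <= (1 - e) * Q t.
  by rewrite ler_wpM2l// subr_ge0 ltW.
have eC : (1 - e) * (e * C) <= C.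
  rewrite mulrA -[leRHS]mul1r ler_wpM2r//; nra.
by apply/andP; split; lra.
Qed.

End DelayCost.

(** * Comparison on the logarithmic scale *)

Section LogScale.
Set Implicit Arguments.
Unset Strict Implicit.
Context {R : realType}.
Implicit Types (t u v a b c p e A K D l : R).

Context (f : R -> R) (f_gt0 : forall u, 0 < u -> 0 < f u)
  (f_sublinear : forall e : R, 0 < e -> \forall u \near +oo, f u <= e * u).
Context (G : R -> R) (G_derive : forall u, 1 <= u -> is_derive u 1 G (f u)^-1).

(** The mean value theorem for [G \o expR]. *)
Lemma log_mean_value a b : 1 <= a -> a < b ->
  exists2 c : R, a < c < b & G b - G a = c / f c * (ln b - ln a).
Proof.
move=> a1 ab; have a0 : 0 < a by exact: lt_le_trans a1.
have b0 : 0 < b by exact: lt_trans ab.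
have lnab : ln a < ln b by rewrite ltr_ln.
have D p : ln a <= p -> is_derive p 1 (G \o expR) ((f (expR p))^-1 * expR p).
  move=> ap; apply: is_derive1_comp; apply: G_derive.
  by apply: (le_trans a1); rewrite -[a]lnK ?posrE// ler_expR.
have [p /andP[ap _]|p /andP[ap _]|p /andP[ap pb]] := mean_value lnab (u := G \o expR)
  (du := fun p => (f (expR p))^-1 * expR p).
- exact: is_derive_continuous (D _ ap).
- exact: D (ltW ap).
rewrite /= !lnK ?posrE// => ->; exists (expR p); last by rewrite [_^-1 * _]mulrC.
by rewrite -{1}[a]lnK ?posrE// -[b]lnK ?posrE// !ltr_expR ap.
Qed.

Lemma reciprocal_primitive_nondecreasing a b : 1 <= a -> a <= b -> G a <= G b.
Proof.
move=> a1 ab; apply: (nondecreasing_increment (du := fun u => (f u)^-1) ab).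
- move=> t /andP[at_ _]; apply: is_derive_continuous (G_derive _).
  exact: le_trans at_.
- by move=> t /andP[at_ _]; apply: G_derive; exact: le_trans (ltW at_).
- move=> t /andP[at_ _]; rewrite invr_ge0 ltW// f_gt0//.
  by apply: lt_trans at_; exact: lt_le_trans a1.
Qed.

(** [1 / f u >= 1 / u] eventually, so [G] grows at least like [ln]. *)
Lemma reciprocal_primitive_unbounded A : \forall v \near +oo, A <= G v.
Proof.
have : \forall u \near +oo, f u <= 1 * u by exact: f_sublinear.
move=> [N [_ hN]]; pose V := Num.max N 0 + 1.
have V1 : 1 <= V by rewrite lerDr le_max lexx orbT.
have V0 : 0 < V by exact: lt_le_trans V1.
have NV : N < V by rewrite ltr_pwDr// le_max lexx.
near=> v; have Vv : V < v by near: v; exact: near_gt.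
have v0 : 0 < v by exact: lt_trans Vv.
have [c /andP[Vc cv] E] := log_mean_value V1 Vv.
have fc : f c <= c by have := hN _ (lt_trans NV Vc); rewrite mul1r.
have c0 : 0 < c by exact: lt_trans Vc.
have : 1 * (ln v - ln V) <= G v - G V.
  rewrite E ler_wpM2r//; first by rewrite subr_ge0 ler_ln ?posrE// ltW.
  by rewrite ler_pdivlMr ?mul1r ?f_gt0.
have : A - G V + ln V <= ln v.
  rewrite -ler_expR [leRHS]lnK ?posrE//; near: v; exact: near_ge.
by rewrite mul1r; lra.
Unshelve. all: by end_near. Qed.

Lemma ln_sublinear e : 0 < e -> \forall p \near +oo, ln p <= e * p.
Proof.
move=> e0; near=> p.
have p0 : 0 < p by near: p; exact: near_gt.
have e20 : 0 < e / 2 by rewrite divr_gt0.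
have h : ln (e / 2 * p) <= e / 2 * p.
  have := @le_ln1Dx R (e / 2 * p - 1); rewrite addrCA subrr addr0.
  have ep := mulr_gt0 e20 p0.
  by move=> /(_ _)/le_trans; apply; lra.
rewrite lnM ?posrE// in h.
have : - ln (e / 2) / (e / 2) <= p by near: p; exact: near_ge.
by rewrite ler_pdivrMr// => h2; lra.
Unshelve. all: by end_near. Qed.

Context (x w : R -> R) (C : R) (C_ge0 : 0 <= C)
  (x_infty : forall A, \forall t \near +oo, A <= x t)
  (w_infty : forall A, \forall t \near +oo, A <= w t)
  (fx_bounded_below : exists2 c : R, 0 < c & \forall t \near +oo, c <= f (x t))
  (G_cost : forall e, 0 < e -> e < 1 -> exists K : R, \forall t \near +oo,
    (1 - e) * (C * ln (f (x t))) - K <= G (w t) - G (x t) <= C * ln (f (x t)) + K).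

Let d t := ln (w t) - ln (x t).

Lemma near_ln_x (P : R -> Prop) :
  (\forall p \near +oo, P p) -> \forall t \near +oo, P (ln (x t)).
Proof.
move=> [N [_ hN]]; apply: filterS (x_infty (expR (N + 1))) => t Nx.
have x0 : 0 < x t by apply: lt_le_trans Nx; exact: expR_gt0.
apply: hN; apply: (@lt_le_trans _ _ (N + 1)); first by rewrite ltrDl.
by rewrite -ler_expR lnK.
Qed.

Let half0 : (0 : R) < 1 / 2. Proof. by rewrite divr_gt0. Qed.
Let half1 : (1 / 2 : R) < 1. Proof. by rewrite ltr_pdivrMr// mul1r ltr1n. Qed.

(** A bounded increment of [G] is a small increment of [ln], because
    [u / f u] is large. *)
Let small_gap K D a b : 1 <= a -> a < b -> 0 < D ->
  (forall u, a <= u -> f u <= D / (`|K| + 1) * u) -> G b - G a <= K ->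
  ln b - ln a < D.
Proof.
move=> a1 ab D0 fu GK.
have [c /andP[ac cb] E] := log_mean_value a1 ab.
have c0 : 0 < c by apply: lt_trans ac; exact: lt_le_trans a1.
have fc := f_gt0 c0; have K1 : 0 < `|K| + 1 by rewrite ltr_wpDl.
have ba : 0 <= ln b - ln a.
  have a0 : 0 < a by exact: lt_le_trans a1.
  by rewrite subr_ge0 ler_ln ?posrE ?(ltW ab)// (lt_trans a0 ab).
have : (`|K| + 1) / D * (ln b - ln a) <= K.
  apply: le_trans GK; rewrite E ler_wpM2r// ler_pdivlMr//.
  have := fu c (ltW ac); rewrite -ler_pdivlMl ?divr_gt0// invf_div => /le_trans; apply.
  exact: lexx.
rewrite mulrAC ler_pdivrMr// => h; rewrite ltNge; apply/negP => Dba.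
have : (`|K| + 1) * D <= K * D by apply: le_trans h; rewrite ler_wpM2l// ltW.
by rewrite ler_pM2r//; have := ler_norm K; lra.
Qed.

(** If [w t < x t], then [G (x t) - G (w t)] is bounded, since [C ln (f (x t))]
    is bounded below. *)
Lemma log_gap_gt_neg D : D < 0 -> \forall t \near +oo, D < d t.
Proof.
move=> D0; have [K hK] := G_cost half0 half1.
have [c c0 hc] := fx_bounded_below.
pose K' := K + C * `|ln c|.
have ND0 : 0 < - D by rewrite oppr_gt0.
have [N [_ hN]] := f_sublinear (divr_gt0 ND0 (ltr_wpDl (normr_ge0 K') ltr01)).
near=> t; have wN : N + 1 <= w t by near: t; exact: w_infty.
have w1 : 1 <= w t by near: t; exact: w_infty.
have cfx : c <= f (x t) by near: t.
have [xw|wx] := leP (x t) (w t).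
  apply: lt_le_trans D0 _; rewrite subr_ge0 ler_ln// posrE.
    have : 1 <= x t by near: t; exact: x_infty.
    exact: lt_le_trans.
  exact: lt_le_trans w1.
rewrite -ltrN2 /d opprB; apply: (small_gap (K := K')) => // [u wu|].
  by apply: hN; apply: lt_le_trans wu; apply: lt_le_trans wN; rewrite ltrDl.
have : (1 - 1 / 2) * (C * ln (f (x t))) - K <= G (w t) - G (x t) <=
    C * ln (f (x t)) + K by near: t.
move=> /andP[+ _]; have : - `|ln c| <= ln (f (x t)).
  have : ln c <= ln (f (x t)) by rewrite ler_ln ?posrE// (lt_le_trans c0).
  by have := ler_norm (- ln c); rewrite normrN; lra.
move=> /(ler_wpM2l C_ge0); rewrite /K'.
have := mulr_ge0 C_ge0 (normr_ge0 (ln c)); lra.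
Unshelve. all: by end_near. Qed.

(** With [C = 0] the cost is bounded, however large [ln (f (x t))] is. *)
Lemma log_gap_lt_pos D : C = 0 -> 0 < D -> \forall t \near +oo, d t < D.
Proof.
move=> C0 D0; have [K hK] := G_cost half0 half1.
have [N [_ hN]] := f_sublinear (divr_gt0 D0 (ltr_wpDl (normr_ge0 K) ltr01)).
near=> t; have xN : N + 1 <= x t by near: t; exact: x_infty.
have x1 : 1 <= x t by near: t; exact: x_infty.
have [wx|xw] := leP (w t) (x t).
  apply: le_lt_trans D0; rewrite subr_le0 ler_ln// posrE; last exact: lt_le_trans x1.
  have : 1 <= w t by near: t; exact: w_infty.
  exact: lt_le_trans.
apply: (small_gap (K := K)) => // [u wu|].
  by apply: hN; apply: lt_le_trans wu; apply: lt_le_trans xN; rewrite ltrDl.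
have : (1 - 1 / 2) * (C * ln (f (x t))) - K <= G (w t) - G (x t) <=
    C * ln (f (x t)) + K by near: t.
by move=> /andP[_]; rewrite C0 mul0r add0r.
Unshelve. all: by end_near. Qed.

(** With [p = ln (x t)]: [(p / l) d <= C p + K], because [c >= x t] in the mean
    value formula and [f (x t) <= x t]; divide by [p]. *)
Lemma log_gap_lt l D : 0 < l ->
  (\forall u \near +oo, f u <= l * (u / ln u)) -> l * C < D ->
  \forall t \near +oo, d t < D.
Proof.
move=> l0 [N [_ hN]] lCD; have [K hK] := G_cost half0 half1.
have [N1 [_ hN1]] := f_sublinear ltr01.
have D0 : 0 < D by apply: le_lt_trans lCD; rewrite mulr_ge0// ltW.
near=> t; have xN : N + 1 <= x t by near: t; exact: x_infty.
have xN1 : N1 + 1 <= x t by near: t; exact: x_infty.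
have x2 : 2 <= x t by near: t; exact: x_infty.
have x1 : 1 < x t by apply: lt_le_trans x2; rewrite ltr1n.
have x0 : 0 < x t by exact: lt_trans x1.
have w0 : 0 < w t.
  have : 1 <= w t by near: t; exact: w_infty.
  exact: lt_le_trans.
have [wx|xw] := leP (w t) (x t).
  by apply: le_lt_trans D0; rewrite subr_le0 ler_ln.
have [c /andP[xc cw] E] := log_mean_value (ltW x1) xw.
have : (1 - 1 / 2) * (C * ln (f (x t))) - K <= G (w t) - G (x t) <=
    C * ln (f (x t)) + K by near: t.
rewrite E -/(d t) => /andP[_ h].
have d0 : 0 < d t by rewrite subr_gt0 ltr_ln.
have p0 : 0 < ln (x t) by exact: ln_gt0.
have c0 : 0 < c by exact: lt_trans xc.
have pc : ln (x t) <= ln c by rewrite ler_ln// ltW.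
have fx : ln (f (x t)) <= ln (x t).
  rewrite ler_ln ?posrE ?f_gt0// -[leRHS]mul1r; apply: hN1.
  by apply: lt_le_trans xN1; rewrite ltrDl.
have fc : ln (x t) / l <= c / f c.
  rewrite ler_pdivlMr ?f_gt0// mulrAC ler_pdivrMr//.
  have : f c <= l * (c / ln c).
    by apply: hN; apply: lt_trans xc; apply: lt_le_trans xN; rewrite ltrDl.
  rewrite mulrA ler_pdivlMr ?(lt_le_trans p0)// => fc.
  rewrite [c * l]mulrC; apply: le_trans fc; rewrite mulrC ler_wpM2l// ltW//.
  exact: f_gt0.
have : ln (x t) / l * d t <= C * ln (x t) + `|K|.
  apply: le_trans (ler_wpM2r (ltW d0) fc) (le_trans h _).
  by rewrite lerD ?ler_norm// ler_wpM2l.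
rewrite mulrAC ler_pdivrMr// => h1.
have : l * `|K| / (D - l * C) < ln (x t).
  near: t; exact: near_ln_x (near_gt _).
rewrite ltr_pdivrMr ?subr_gt0// => big.
rewrite -(ltr_pM2l p0); nra.
Unshelve. all: by end_near. Qed.

(** With [p = ln (x t)]: [ln (f (x t)) >= (1 - e) p], hence
    [(1 - e)^2 C p - K <= (c / f c) d].  If [d <= D], then [ln c <= p + D] and the
    right-hand side is at most [(p + D) D / l]; for large [p] this contradicts
    [D < l (1 - e)^2 C]. *)
Lemma log_gap_gt l D : 0 < l -> 0 < C ->
  (\forall u \near +oo, l * (u / ln u) <= f u) -> D < l * C ->
  \forall t \near +oo, D < d t.
Proof.
move=> l0 C0 [N [_ hN]].
wlog D0 : D / 0 <= D.
  move=> H DlC; have [D0|D0] := leP 0 D; first exact: H.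
  apply: filterS (H 0 (lexx _) (mulr_gt0 l0 C0)) => t; exact: lt_trans.
move=> DlC; have lC := mulr_gt0 l0 C0.
(* With e := (1 - rho) / 2, (1 - e) ^+ 2 exceeds 1 - 2 * e = rho. *)
pose rho := D / (l * C).
have rho0 : 0 <= rho by rewrite divr_ge0// ltW.
have rho1 : rho < 1 by rewrite ltr_pdivrMr// mul1r.
pose e := (1 - rho) / 2.
have e0 : 0 < e by rewrite /e; lra.
have e1 : e < 1 by rewrite /e; lra.
have rhoe : rho < (1 - e) ^+ 2.
  have -> : rho = 1 - 2 * e by rewrite /e; field.
  rewrite expr2; nra.
pose B := l * ((1 - e) ^+ 2 * C).
have DB : D < B.
  have -> : D = rho * (l * C) by rewrite /rho divfK ?gt_eqF.
  by rewrite /B [ltRHS]mulrCA ltr_pM2r.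
have [K hK] := G_cost e0 e1.
near=> t; have xN : N + 1 <= x t by near: t; exact: x_infty.
have x2 : 2 <= x t by near: t; exact: x_infty.
have x1 : 1 < x t by apply: lt_le_trans x2; rewrite ltr1n.
have x0 : 0 < x t by exact: lt_trans x1.
have w1 : 1 <= w t by near: t; exact: w_infty.
have w0 : 0 < w t by exact: lt_le_trans w1.
pose p := ln (x t); have p0 : 0 < p by exact: ln_gt0.
have fx : (1 - e) * p <= ln (f (x t)).
  have : ln (l * (x t / p)) <= ln (f (x t)).
    have lxp : 0 < l * (x t / p) by rewrite mulr_gt0// divr_gt0.
    rewrite ler_ln ?posrE ?f_gt0//; apply: hN.
    by apply: lt_le_trans xN; rewrite ltrDl.
  apply: le_trans; rewrite lnM ?posrE ?divr_gt0// ln_div ?posrE//.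
  have : ln p <= e / 2 * p.
    rewrite /p; near: t; apply: (near_ln_x (P := fun p => ln p <= e / 2 * p)).
    by apply: ln_sublinear; rewrite divr_gt0.
  have : - ln l / (e / 2) <= p.
    by rewrite /p; near: t; exact: near_ln_x (near_ge _).
  rewrite ler_pdivrMr ?divr_gt0// -/p; lra.
have : (1 - e) * (C * ln (f (x t))) - K <= G (w t) - G (x t) <=
    C * ln (f (x t)) + K by near: t.
move=> /andP[h _].
have h1 : (1 - e) ^+ 2 * C * p - K <= G (w t) - G (x t).
  apply: le_trans h; rewrite lerD2r expr2 -!mulrA ler_wpM2l ?subr_ge0 ?(ltW e1)//.
  by rewrite mulrCA ler_wpM2l ?(ltW C0).
have c1 : 0 < (1 - e) ^+ 2 * C by rewrite mulr_gt0// exprn_gt0// subr_gt0.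
have big1 : K / ((1 - e) ^+ 2 * C) < p.
  by rewrite /p; near: t; exact: near_ln_x (near_gt _).
rewrite ltr_pdivrMr// in big1.
have big2 : (l * K + D * D) / (B - D) < p.
  by rewrite /p; near: t; exact: near_ln_x (near_gt _).
rewrite ltr_pdivrMr ?subr_gt0// in big2.
have xw : x t < w t.
  rewrite ltNge; apply/negP => /(reciprocal_primitive_nondecreasing w1) wx; lra.
have [c /andP[xc cw] E] := log_mean_value (ltW x1) xw.
have c0 : 0 < c by exact: lt_trans xc.
have c_gt1 : 1 < c by exact: lt_trans xc.
have d0 : 0 < d t by rewrite subr_gt0 ltr_ln.
rewrite ltNge; apply/negP => dD.
have fc : c / f c <= (p + D) / l.
  have lncw : ln c <= p + D.
    have : ln c <= ln (w t) by rewrite ler_ln ?posrE ?ltW.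
    by move: dD; rewrite /d -/p; lra.
  rewrite ler_pdivrMr ?f_gt0// mulrAC ler_pdivlMr//.
  have : l * (c / ln c) <= f c.
    by apply: hN; apply: lt_trans xc; apply: lt_le_trans xN; rewrite ltrDl.
  rewrite mulrA ler_pdivrMr ?ln_gt0// => fc.
  rewrite [c * l]mulrC; apply: le_trans fc _.
  by rewrite [leRHS]mulrC ler_wpM2l// ltW// f_gt0.
have : G (w t) - G (x t) <= (p + D) / l * D.
  by rewrite E -/(d t) ler_pM// ltW ?divr_gt0 ?f_gt0.
move=> /(le_trans h1); rewrite [(p + D) / l * D]mulrAC ler_pdivlMr// => h2.
by move: big2; rewrite /B; nra.
Unshelve. all: by end_near. Qed.

End LogScale.

(** * F and its inverse *)

Section InverseOfF.
Set Implicit Arguments.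
Unset Strict Implicit.
Context {R : realType}.
Implicit Types (t u v y e : R).
Context (f : R -> R)
    (f_derivable : forall u : R, 0 < u -> derivable f u 1)
    (f_gt0 : forall u : R, 0 < u -> 0 < f u)
    (f'_cvg0 : f^`() u @[u --> +oo] --> 0).

Lemma sublinear_of_derivative_cvg0 e : 0 < e -> \forall u \near +oo, f u <= e * u.
Proof.
move=> e0; have e20 : 0 < e / 2 by rewrite divr_gt0.
have [N N0 hN] := derivative_small f'_cvg0 e20.
near=> u; have Nu : N < u by near: u; exact: near_gt.
have [t /andP[Nt _]|t /andP[Nt _]|c /andP[Nc cu] E] :=
  @mean_value _ f f^`() _ _ Nu.
- by apply: half_line_continuous => //; exact: lt_le_trans Nt.
- by apply: half_line_is_derive => //; exact: lt_trans Nt.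
have fN : f N / (e / 2) <= u by near: u; exact: near_ge.
rewrite ler_pdivrMr// in fN.
have : f^`()%classic c * (u - N) <= e / 2 * (u - N).
  rewrite ler_wpM2r ?subr_ge0 ?(ltW Nu)//.
  exact: le_trans (ler_norm _) (hN _ (ltW Nc)).
have : 0 <= e / 2 * N by rewrite mulr_ge0 ?ltW.
by rewrite -E; lra.
Unshelve. all: by end_near. Qed.

Lemma F_eq_increment : exists2 G : R -> R,
  (forall u, 1 <= u -> is_derive u 1 G (f u)^-1) &
  (forall v, 1 <= v -> F f v = G v - G 1).
Proof.
have half_gt0 : (0 : R) < 1 / 2 by rewrite divr_gt0.
have half_lt1 : (1 / 2 : R) < 1 by rewrite ltr_pdivrMr// mul1r ltr1n.
(* The cutoff below 1 makes 1 / f continuous on the whole line, with room to the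
   left of 1 for a two-sided derivative there. *)
pose g u := (f (Num.max u (1 / 2)))^-1.
have max0 u : 0 < Num.max u (1 / 2) by rewrite lt_max half_gt0 orbT.
have cg : continuous g.
  move=> u; apply: (@continuousV _ _ (fun u => f (Num.max u (1 / 2)))).
    by rewrite gt_eqF// f_gt0.
  apply: (@continuous_comp _ _ _ (fun u => Num.max u (1 / 2))).
    exact: continuous_maxr.
  exact: half_line_continuous.
have gE u : 1 <= u -> g u = (f u)^-1.
  by move=> u1; rewrite /g (max_idPl _)// (le_trans (ltW half_lt1)).
have [G cG DG] := primitive (1 / 2) cg.
have DG' u : 1 <= u -> is_derive u 1 G (f u)^-1.
  by move=> u1; rewrite -gE//; apply: DG; exact: lt_le_trans u1.
exists G => // v v1; rewrite /F v1.
move: v1; rewrite le_eqVlt => /predU1P[<-|v1].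
  by rewrite subrr set_itv1 Rintegral_set1.
transitivity (\int[lebesgue_measure]_(u in `[1, v]) g u).
  apply: eq_Rintegral.
  by move=> u; rewrite inE/= in_itv/= => /andP[u1 _]; rewrite gE// div1r.
rewrite /Rintegral (continuous_FTC2 (F := G) v1)//.
- exact: continuous_subspaceT.
- split.
  + move=> u; rewrite in_itv/= => /andP[u1 _].
    by have [] := DG' _ (ltW u1).
  + by apply: cvg_at_right_filter; exact: cG.
  + by apply: cvg_at_left_filter; exact: cG.
- move=> u; rewrite in_itv/= => /andP[u1 _]; rewrite gE ?ltW// derive1E.
  by have [] := DG' _ (ltW u1).
Qed.

(** Values of [F] left of 1 are nonpositive, so they never compete in the choice
    of a preimage of a positive number. *)
Lemma F_le0 v : 0 < v -> v < 1 -> F f v <= 0.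
Proof.
move=> v0 v1; have v1' : (1 <= v) = false by rewrite leNgt v1.
rewrite /F v1' oppr_le0; apply: Rintegral_ge0 => u /=.
rewrite in_itv/= => /andP[vu _]; rewrite divr_ge0// ltW// f_gt0//.
exact: lt_le_trans vu.
Qed.

Lemma FinvK y : 0 < y -> 1 <= Finv f y /\ F f (Finv f y) = y.
Proof.
move=> y0; have [G DG FE] := F_eq_increment.
have [V V1 yV] : exists2 V, 1 <= V & y <= G V - G 1.
  have : \forall v \near +oo, 1 <= v /\ y + G 1 <= G v.
    near=> v; split; first by near: v; exact: near_ge.
    near: v; apply: reciprocal_primitive_unbounded DG _ => //.
    exact: sublinear_of_derivative_cvg0.
  move=> [N [_ hN]]; have [V1 yV] : 1 <= N + 1 /\ y + G 1 <= G (N + 1).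
    by apply: hN; rewrite ltrDl.
  by exists (N + 1) => //; rewrite lerBrDr.
have cG : {within `[1, V], continuous G}.
  by apply: within_segment => t /andP[t1 _]; exact: is_derive_continuous (DG _ t1).
have [|u u1V Gu] := IVT V1 cG (v := y + G 1).
  by rewrite ge_min le_max; apply/andP; split; apply/orP; [left|right]; lra.
have Fsurj : set_surj `]0, +oo[ [set y] (F f).
  move=> _ ->; exists u; last first.
    by move: u1V; rewrite in_itv/= => /andP[u1 _]; rewrite FE// Gu addrK.
  move: u1V; rewrite /= !in_itv/= andbT => /andP[u1 _].
  exact: lt_le_trans u1.
have Fw : F f (Finv f y) = y by apply: (surjpK _ Fsurj); rewrite inE.
have : Finv f y > 0.
  have : `]0, +oo[%classic (Finv f y).
    by apply: (surjpinv_image_sub Fsurj); exists y.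
  by rewrite /= in_itv/= andbT.
move=> w0; split=> //; rewrite leNgt; apply/negP => /(F_le0 w0).
by rewrite Fw leNgt y0.
Unshelve. all: by end_near. Qed.

End InverseOfF.

(** * The limit of the ratio *)

(** The eventual bounds encode [d] tending to [L], finite or [+oo], in the form
    produced by the comparison on the logarithmic scale. *)
Lemma expR_opp_cvg {R : realType} (d r : R -> R) (L : \bar R) : L != -oo%E ->
  (forall D : R, (D%:E < L)%E -> \forall t \near +oo, D < d t) ->
  (forall D : R, (L < D%:E)%E -> \forall t \near +oo, d t < D) ->
  (\forall t \near +oo, expR (- d t) = r t) ->
  (r t)%:E @[t --> +oo] --> expeR (- L).
Proof.
move=> L_Ny lower upper rE.
have suff_cvg (l : R) : expR (- d t) @[t --> +oo] --> l ->
    (r t)%:E @[t --> +oo] --> l%:E.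
  move=> dl; apply: cvg_EFin; first exact: nearW.
  apply: cvg_trans dl; apply: near_eq_cvg.
  by apply: filterS rE => t /= ->.
case: L L_Ny lower upper => [l| |//] _ lower upper /=.
  apply: suff_cvg; apply: (@cvg_comp _ _ _ (fun t => - d t) expR _ (nbhs (- l))).
    apply: cvgN; apply/cvgrPdist_lt => e e0; near=> t.
    have lo : l - e < d t by near: t; apply: lower; rewrite lte_fin gtrBl.
    have up : d t < l + e by near: t; apply: upper; rewrite lte_fin ltrDl.
    by rewrite ltr_distlC lo.
  exact: continuous_expR.
apply: suff_cvg; apply/cvgrPdist_lt => e e0; near=> t.
rewrite sub0r normrN ger0_norm ?expR_ge0// -ltr_ln ?posrE ?expR_gt0// expRK ltrNl.
near: t; apply: lower; exact: ltry.
Unshelve. all: by end_near. Qed.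

Theorem theorem2 (R : realType) (f : R -> R)
    (f_derivable : forall u : R, 0 < u -> derivable f u 1)
    (f'_continuous : forall u : R, 0 < u -> {for u, continuous f^`()})
    (f_gt0 : forall u : R, 0 < u -> 0 < f u)
    (f'_gt0 : exists x1 : R, forall u : R, x1 < u -> 0 < f^`() u)
    (f'_cvg0 : f^`() u @[u --> +oo] --> 0)
    (f'_RV : regularly_varying f^`() 0)
    (lambda : \bar R) (lambda_ge0 : (0 <= lambda)%E)
    (lambdaE : (f u / (u / ln u))%:E @[u --> +oo] --> lambda)
    (tau : R) (tau_gt0 : 0 < tau)
    (mu : {finite_measure set (measurableTypeR R) -> \bar R})
    (M : R) (ME : M = \int[mu]_(s in `[- tau, 0]) 1) (M_gt0 : 0 < M)
    (C : R) (CE : C = \int[mu]_(s in `[- tau, 0]) `|s|)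
    (psi : R -> R) (psi_continuous : {within `[- tau, 0], continuous psi})
    (psi_gt0 : forall t : R, - tau <= t <= 0 -> 0 < psi t) :
  exists x : R -> R,
    [/\ is_solution tau mu f psi x,
        forall y, is_solution tau mu f psi y ->
          forall t : R, - tau <= t -> y t = x t
      & (x t / Finv f (M * t))%:E @[t --> +oo] --> expeR (- (lambda * C%:E))].
Proof.
have {ME} ME : M = delay_mass tau mu by rewrite ME Rintegral_cst// mul1r.
have {}CE : C = delay_integral tau mu Num.Def.normr by exact: CE.
have mass_gt0 : 0 < delay_mass tau mu by rewrite -ME.
have [x [m m0 [cx x_ge Dx x_sol x_uniq]]] := delay_well_posed f_derivable
  f'_continuous f_gt0 f'_cvg0 tau_gt0 mu psi_continuous psi_gt0.
exists x; split => //.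
pose w t := Finv f (M * t).
have [G DG FE] := F_eq_increment f_derivable f_gt0.
have wP (t : R) : 0 < t -> 1 <= w t /\ G (w t) = M * t + G 1.
  move=> t0; have [w1 Fw] :=
    FinvK f_derivable f_gt0 f'_cvg0 (mulr_gt0 M_gt0 t0).
  by split => //; rewrite -Fw FE// subrK.
have fsub := sublinear_of_derivative_cvg0 f_derivable f'_cvg0.
have Gmono := reciprocal_primitive_nondecreasing f_gt0 DG.
have x_infty (A : R) : \forall t \near +oo, A <= x t.
  have [T _ hT] := solution_unbounded f_derivable f_gt0 f'_gt0 mass_gt0 m0 cx
    x_ge Dx A.
  by apply: filterS (near_ge T) => t; exact: hT.
have w_infty (A : R) : \forall t \near +oo, A <= w t.
  near=> t; have t0 : 0 < t by near: t; exact: near_gt.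
  have [w1 Gw] := wP _ t0; rewrite leNgt; apply/negP => wA.
  have := Gmono _ _ w1 (ltW wA); rewrite Gw leNgt => /negP; apply.
  rewrite -ltrBlDr mulrC -ltr_pdivrMr//; near: t; exact: near_gt.
have fx_low : exists2 c : R, 0 < c & \forall t \near +oo, c <= f (x t).
  have [c c0 fc] := f_bounded_below f_derivable f_gt0 f'_gt0 m0.
  by exists c => //; apply: nearW => t; exact: fc.
have C0 : 0 <= C by rewrite CE; exact: delay_integral_ge0.
have cost (e : R) : 0 < e -> e < 1 -> exists K : R, \forall t \near +oo,
    (1 - e) * (C * ln (f (x t))) - K <= G (w t) - G (x t) <=
    C * ln (f (x t)) + K.
  move=> e0 e1; have [K [T hK]] := delay_cost_asymptotics
    f_derivable f_gt0 f'_gt0 f'_cvg0 tau_gt0 mass_gt0 m0 cx x_ge Dx DG e0 e1.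
  exists (K + `|G 1|); near=> t.
  have t0 : 0 < t by near: t; exact: near_gt.
  have Tt : T <= t by near: t; exact: near_ge.
  have [_ ->] := wP _ t0; have := hK t Tt.
  rewrite -ME -CE.
  have := ler_norm (G 1); have := ler_norm (- G 1); rewrite normrN.
  by move=> ? ? /andP[? ?]; apply/andP; split; lra.
pose L := (lambda * C%:E)%E.
have L_Ny : L != -oo%E.
  by rewrite gt_eqF// (lt_le_trans (ltNy0))// mule_ge0.
have near1 (u : R) : 1 < u -> 0 < u / ln u.
  by move=> u1; rewrite divr_gt0 ?ln_gt0// (lt_trans ltr01).
have f_lower (l : R) : (l%:E < lambda)%E -> \forall u \near +oo, l * (u / ln u) <= f u.
  move=> ll; have := lambdaE _ (open_ereal_gt' ll) => h.
  have {}h : \forall u \near +oo, l < f u / (u / ln u) by [].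
  near=> u; rewrite -ler_pdivlMr; first by apply: ltW; near: u.
  by apply: near1; near: u; exact: near_gt.
have f_upper (l : R) : (lambda < l%:E)%E -> \forall u \near +oo, f u <= l * (u / ln u).
  move=> ll; have := lambdaE _ (open_ereal_lt' ll) => h.
  have {}h : \forall u \near +oo, f u / (u / ln u) < l by [].
  near=> u; rewrite -ler_pdivrMr; first by apply: ltW; near: u.
  by apply: near1; near: u; exact: near_gt.
apply: (@expR_opp_cvg _ (fun t => ln (w t) - ln (x t))) => //.
- move=> D DL; have [D0|D0] := ltP D 0.
    exact: (log_gap_gt_neg f_gt0 fsub DG C0 x_infty w_infty fx_low cost).
  have C1 : 0 < C.
    rewrite lt_neqAle C0 andbT eq_sym; apply/eqP => C00.
    by move: DL; rewrite C00 mule0 lte_fin ltNge D0.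
  have [l [l0 ll DlC]] : exists l : R, [/\ 0 < l, (l%:E < lambda)%E & D < l * C].
    have DC : 0 <= D / C by rewrite divr_ge0.
    case: lambda DL {lambda_ge0 lambdaE L L_Ny f_lower f_upper} => [r| |].
    + rewrite lte_fin -ltr_pdivrMr// => Dr; exists ((r + D / C) / 2).
      by split; rewrite ?lte_fin -?ltr_pdivrMr//; lra.
    + move=> _; exists (D / C + 1); split; rewrite ?ltry//; first lra.
      by rewrite -ltr_pdivrMr// ltrDl.
    + by rewrite mulNyr gtr0_sg// mul1e.
  exact: (log_gap_gt f_gt0 DG x_infty w_infty cost l0 C1 (f_lower _ ll) DlC).
- move=> D LD; move: C0; rewrite le_eqVlt => /predU1P[C00|C1].
    apply: (log_gap_lt_pos f_gt0 fsub DG x_infty w_infty cost) => //.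
    by move: LD; rewrite -C00 mule0 lte_fin.
  have [l [l0 ll lCD]] : exists l : R, [/\ 0 < l, (lambda < l%:E)%E & l * C < D].
    case: lambda LD lambda_ge0 {lambdaE L L_Ny f_lower f_upper} => [r| |].
    + rewrite lte_fin lee_fin -ltr_pdivlMr// => Dr r0; exists ((r + D / C) / 2).
      by split; rewrite ?lte_fin -?ltr_pdivlMr//; lra.
    + by rewrite mulyr gtr0_sg// mul1e.
    + by [].
  exact: (log_gap_lt f_gt0 fsub DG (ltW C1) x_infty w_infty cost l0
    (f_upper _ ll) lCD).
- near=> t; have t0 : 0 < t by near: t; exact: near_gt.
  have x0 : 0 < x t by exact: lt_le_trans (x_ge t).
  have w0 : 0 < w t by have [w1 _] := wP _ t0; exact: lt_le_trans w1.
  by rewrite opprB expRD expRN !lnK.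
Unshelve. all: by end_near. Qed.
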